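(* Let $(\mathcal{E},u)$ and $(\mathcal{F},v)$ be spatial Arveson systems. Then for all $0\le s<t\le1$ $$\mathrm{P}^{\mathcal{E}\,{}_u\otimes_v\mathcal{F}}_{s,t}=J_{\mathcal{E}\otimes v,\,u\otimes\mathcal{F}}\bigl(1_{\{(Z_1,Z_2):\,Z_1\cap Z_2\cap[s,t]=\emptyset\}}\bigr).$$
   Context: An Arveson system is a measurable family $\mathcal{E}=(\mathcal{E}_t)_{t\ge0}$ of separable complex Hilbert spaces (measurable structure in the usual sense of Arveson's product systems) with a measurable family of unitaries $V_{s,t}:\mathcal{E}_s\otimes\mathcal{E}_t\to\mathcal{E}_{s+t}$, $s,t\ge0$, satisfying $V_{r,s+t}(1_{\mathcal{E}_r}\otimes V_{s,t})=V_{r+s,t}(V_{r,s}\otimes 1_{\mathcal{E}_t})$; one identifies $\mathcal{E}_s\otimes\mathcal{E}_t$ with $\mathcal{E}_{s+t}$. A subsystem $\mathcal{G}\subseteq\mathcal{E}$ is an Arveson system consisting of closed subspaces $\mathcal{G}_t\subseteq\mathcal{E}_t$ with product unitaries the restrictions of the $V_{s,t}$. A normalised unit is a measurable section $u=(u_t)_{t\ge0}$ of unit vectors $u_t\in\mathcal{E}_t$ with $u_{s+t}=u_s\otimes u_t$; $(\mathcal{E},u)$ is then called a spatial Arveson system. Subsystems form a complete lattice under fibrewise inclusion; $\mathcal{G}\vee\mathcal{G}'$ is the smallest subsystem containing both. $\mathcal{E}\otimes\mathcal{F}$ has fibres $\mathcal{E}_t\otimes\mathcal{F}_t$. The spatial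 product is $\mathcal{E}\,{}_u\!\otimes_v\mathcal{F}:=(u\otimes\mathcal{F})\vee(\mathcal{E}\otimes v)\subseteq\mathcal{E}\otimes\mathcal{F}$, where $u\otimes\mathcal{F}=(\mathbb{C}u_t\otimes\mathcal{F}_t)_t$ and $\mathcal{E}\otimes v=(\mathcal{E}_t\otimes\mathbb{C}v_t)_t$. For a subsystem $\mathcal{G}$ of an Arveson system $\mathcal{H}$ and $0\le s<t\le1$ put $$\mathrm{P}^{\mathcal{G}}_{s,t}=1_{\mathcal{H}_s}\otimes\mathrm{Pr}_{\mathcal{G}_{t-s}}\otimes1_{\mathcal{H}_{1-t}}\in\mathcal{B}(\mathcal{H}_s\otimes\mathcal{H}_{t-s}\otimes\mathcal{H}_{1-t})=\mathcal{B}(\mathcal{H}_1),$$ where $\mathrm{Pr}$ denotes orthogonal projection. Let $\mathcal{C}_{[0,1]}$ be the compact separable space of closed subsets of $[0,1]$ (including $\emptyset$) with its Borel $\sigma$-field. A measure type is an equivalence class of probability measures having the same null sets. Known fact (to be used as definition): if $\mathcal{G}_1,\mathcal{G}_2$ are subsystems of $\mathcal{H}$ such that the projection families $\mathrm{P}^{\mathcal{G}_1},\mathrm{P}^{\mathcal{G}_2}$ commute, then for each normal state $\omega$ on $\mathcal{B}(\mathcal{H}_1)$ there is a unique probability measure $\mu_\omega$ on $\mathcal{C}_{[0,1]}\times\mathcal{C}_{[0,1]}$ with $$\mu_\omega\bigl(\{(Z_1,Z_2):Z_j\cap\textstyle\bigcup_i[s_i^j,t_i^j]=\emptyset,\ j=1,2\}\bigr)=\omega\Bigl(\prod_{j}\prod_i\mathrm{P}^{\mathcal{G}_j}_{s_i^j,t_i^j}\Bigr)$$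 for all finite families of intervals in $[0,1]$; the measures $\mu_\omega$ for faithful $\omega$ belong to a common measure type, denoted $\mathcal{M}^{\mathcal{G}_1,\mathcal{G}_2}$; and there is a unique normal $*$-isomorphism $J_{\mathcal{G}_1,\mathcal{G}_2}$ from $L^\infty(\mathcal{M}^{\mathcal{G}_1,\mathcal{G}_2})$ onto its image in $\mathcal{B}(\mathcal{H}_1)$ (the von Neumann algebra generated by both families) with $$J_{\mathcal{G}_1,\mathcal{G}_2}\bigl(1_{\{(Z_1,Z_2):Z_j\cap[s,t]=\emptyset\}}\bigr)=\mathrm{P}^{\mathcal{G}_j}_{s,t},\qquad j=1,2,\ 0\le s<t\le1.$$ In the claim this is applied with $\mathcal{H}=\mathcal{E}\otimes\mathcal{F}$, $\mathcal{G}_1=\mathcal{E}\otimes v$, $\mathcal{G}_2=u\otimes\mathcal{F}$, and the projections on the left-hand side are those of the subsystem $\mathcal{E}\,{}_u\!\otimes_v\mathcal{F}$ of $\mathcal{E}\otimes\mathcal{F}$. *)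

(* Defs.v *)
From HB Require Import structures.
From mathcomp Require Import all_boot all_order all_algebra.
From mathcomp Require Import all_classical all_reals all_analysis.
From mathcomp Require Import complex.

Set Implicit Arguments.
Unset Strict Implicit.
Unset Printing Implicit Defensive.

Import Order.TTheory GRing.Theory Num.Theory.
Import numFieldNormedType.Exports.

Local Open Scope classical_set_scope.
Local Open Scope ring_scope.
Local Open Scope complex_scope.

Record hilbert (R : realType) := Hilbert {
  hcarrier :> completeNormedModType R[i];
  hdot : {dot hcarrier for (@Num.conj R[i])};
  hdotE : forall x : hcarrier, hdot x x = `|x| ^+ 2 }.

Definition ip (R : realType) (H : hilbert R) (x y : H) : R[i] := hdot H x y.

Definition closed_subspace (R : realType) (H : hilbert R) (V : set H) : Prop :=
  [/\ closed V, V 0 & forall (a : R[i]) x y, V x -> V y -> V (a *: x + y)].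

Definition closed_span (R : realType) (H : hilbert R) (X : set H) : set H :=
  \bigcap_(V in [set V : set H | closed_subspace V /\ X `<=` V]) V.

Definition orth_proj (R : realType) (H : hilbert R) (V : set H) (x : H) : H :=
  get [set p : H | V p /\ forall y, V y -> ip (x - p) y = 0].

(* W, with m for the elementary tensors, is the Hilbert space tensor product
   of U and V; equivalently, m induces a unitary from that product onto W. *)
Definition hilbert_tensor (R : realType) (U V W : hilbert R)
    (m : {bilinear U -> V -> W}) : Prop :=
  (forall x x' y y', ip (m x y) (m x' y') = ip x x' * ip y y') /\
  closed_span [set m x y | x in [set: U] & y in [set: V]] = [set: W].

Definition bounded_op (R : realType) (H : hilbert R) (A : H -> H) : Prop :=
  linear A /\ continuous A.

Definition op_le (R : realType) (H : hilbert R) (A B : H -> H) : Prop :=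
  forall x : H, ip (A x) x <= ip (B x) x.

Definition positive_op (R : realType) (H : hilbert R) (A : H -> H) : Prop :=
  bounded_op A /\ op_le (fun=> 0) A.

Definition adjoint_ops (R : realType) (H : hilbert R) (A B : H -> H) : Prop :=
  forall x y : H, ip (A x) y = ip x (B y).

Definition cmeasurable (R : realType) d (T : measurableType d) (D : set T)
    (f : T -> R[i]) : Prop :=
  measurable_fun D (fun x => complex.Re (f x)) /\
  measurable_fun D (fun x => complex.Im (f x)).

Notation section E := (forall t, hcarrier (E t)).

(* A measurable field of separable Hilbert spaces over [0, +oo[ given by its
   set of measurable sections; separability of the fibres is part of the last
   clause. Fibres at negative times are junk, here and below. *)
Definition measurable_field (R : realType) (E : R -> hilbert R)
    (M : set (section E)) : Prop :=
  [/\ forall x y, M x -> M y ->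
        cmeasurable [set t : R | 0 <= t] (fun t : R => ip (x t) (y t)),
      forall y : section E,
        (forall x, M x ->
           cmeasurable [set t : R | 0 <= t] (fun t : R => ip (x t) (y t))) ->
        M y
    & exists x : nat -> section E, (forall n, M (x n)) /\
        forall t, 0 <= t -> closed_span (range (fun n => x n t)) = [set: E t]].

(* The product unitaries V_{s,t} are given on elementary tensors; the target
   index r with s + t = r avoids transports along equalities of times. *)
Record arveson (R : realType) := Arveson {
  fibre :> R -> hilbert R;
  msection : set (section fibre);
  amul : forall s t r : R, s + t = r ->
    {bilinear fibre s -> fibre t -> fibre r};
  arveson_field : measurable_field msection;
  arveson_unitary : forall (s t r : R) (e : s + t = r),
    0 <= s -> 0 <= t -> hilbert_tensor (amul e);
  arveson_assoc : forall (r s t rs st q : R) (e1 : r + s = rs)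
      (e2 : rs + t = q) (e3 : s + t = st) (e4 : r + st = q),
    0 <= r -> 0 <= s -> 0 <= t ->
    forall x y z, amul e2 (amul e1 x y) z = amul e4 x (amul e3 y z);
  arveson_measurable : forall x y z : section fibre,
    msection x -> msection y -> msection z ->
    cmeasurable [set p : R * R | 0 <= p.1 /\ 0 <= p.2]
      (fun p : R * R =>
         ip (amul (erefl (p.1 + p.2)) (x p.1) (y p.2)) (z (p.1 + p.2))) }.

Arguments amul {R E s t r} e : rename.

Definition normalised_unit (R : realType) (E : arveson R) (u : section E) : Prop :=
  [/\ msection u, forall t, 0 <= t -> `|u t| = 1
    & forall (s t r : R) (e : s + t = r), 0 <= s -> 0 <= t ->
        u r = amul e (u s) (u t)].

Definition subsystem (R : realType) (H : arveson R)
    (G : forall t, set (H t)) : Prop :=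
  [/\ forall t, 0 <= t -> closed_subspace (G t),
      forall (s t r : R) (e : s + t = r), 0 <= s -> 0 <= t ->
        closed_span [set amul e x y | x in G s & y in G t] = G r
    & exists x : nat -> section H,
        (forall n, msection (x n) /\ forall t, 0 <= t -> G t (x n t)) /\
        forall t, 0 <= t -> closed_span (range (fun n => x n t)) = G t].

(* The smallest subsystem containing both: subsystems form a complete lattice,
   in which infima are fibrewise intersections. *)
Definition subsystem_join (R : realType) (H : arveson R)
    (G G' : forall t, set (H t)) (t : R) : set (H t) :=
  [set x | forall K : forall t, set (H t), subsystem K ->
     (forall r, 0 <= r -> G r `<=` K r /\ G' r `<=` K r) -> K t x].

(* E (x) F, determined up to isomorphism by these properties: the last one
   fixes the measurable structure, which is maximal by [measurable_field]. *)
Record tensor_system (R : realType) (E F : arveson R) := TensorSystem {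
  tsystem :> arveson R;
  tmap : forall t, {bilinear E t -> F t -> tsystem t};
  tmap_tensor : forall t, 0 <= t -> hilbert_tensor (tmap t);
  tmap_amul : forall (s t r : R) (e : s + t = r), 0 <= s -> 0 <= t ->
    forall x x' y y', amul e (tmap s x y) (tmap t x' y') =
                      tmap r (amul e x x') (amul e y y');
  tmap_msection : forall (x : section E) (y : section F),
    msection x -> msection y -> msection (fun t => tmap t (x t) (y t)) }.

Arguments tmap {R E F} T t : rename.

Definition line (R : realType) (H : hilbert R) (x : H) : set H :=
  [set a *: x | a in [set: R[i]]].

Section spatial_product.
Context (R : realType) (E F : arveson R) (T : tensor_system E F).

Definition tensor_subspace t (V : set (E t)) (W : set (F t)) : set (T t) :=
  closed_span [set tmap T t x y | x in V & y in W].

Definition unit_tensor (u : section E) t : set (T t) :=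
  tensor_subspace (line (u t)) [set: F t].

Definition tensor_unit (v : section F) t : set (T t) :=
  tensor_subspace [set: E t] (line (v t)).

Definition spatial_product (u : section E) (v : section F) :
    forall t, set (T t) :=
  subsystem_join (unit_tensor u) (tensor_unit v).

End spatial_product.

Arguments unit_tensor {R E F} T u t.
Arguments tensor_unit {R E F} T v t.
Arguments spatial_product {R E F} T u v t.

(* x (x) y (x) z in H_s (x) H_{t-s} (x) H_{1-t} = H_1 *)
Definition amul3 (R : realType) (H : arveson R) (s t : R)
    (x : H s) (y : H (t - s)) (z : H (1 - t)) : H 1 :=
  amul (subrKC t 1) (amul (subrKC s t) x y) z.

(* 1 (x) Pr_{G_{t-s}} (x) 1 *)
Definition proj_op (R : realType) (H : arveson R) (G : forall t, set (H t))
    (s t : R) : H 1 -> H 1 :=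
  get [set A : H 1 -> H 1 | bounded_op A /\
    forall x y z, A (amul3 x y z) = amul3 x (orth_proj (G (t - s)) y) z].

Definition proj_prod (R : realType) (H : arveson R) (G : forall t, set (H t))
    (L : seq (R * R)) : H 1 -> H 1 :=
  foldr (fun p A => proj_op G p.1 p.2 \o A) idfun L.

Record closed01 (R : realType) := Closed01 {
  closed01_set :> set R;
  closed01_closed : closed closed01_set;
  closed01_sub : closed01_set `<=` `[0, 1] }.

Section closed01_topology.
Context (R : realType).

HB.instance Definition _ := gen_eqMixin (closed01 R).
HB.instance Definition _ := gen_choiceMixin (closed01 R).
HB.instance Definition _ :=
  isPointed.Build (closed01 R) (Closed01 (@closed0 R) (@sub0set _ _)).

(* Hit-or-miss (Fell) topology. As [0, 1] is compact it is the Vietoris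
   topology, i.e., that of the Hausdorff metric with the empty set isolated. *)
Definition closed01_subbase : set (set (closed01 R)) :=
  [set A |
     (exists2 K : set R, compact K &
        A = [set Z | closed01_set Z `&` K = set0]) \/
     (exists2 U : set R, open U &
        A = [set Z | closed01_set Z `&` U !=set0])].

HB.instance Definition _ :=
  isSubBaseTopological.Build (closed01 R) closed01_subbase id.

HB.instance Definition _ := Measurable.copy (closed01 R)
  (g_sigma_algebraType (@open (closed01 R))).

End closed01_topology.

(* The topology is second countable, so that the product sigma-algebra used
   here is the Borel sigma-algebra of the product. *)
Notation pair01 R := (closed01 R * closed01 R)%type.

Definition is_lub (T : Type) (D : set T) (le : T -> T -> Prop) (S : set T)
    (a : T) : Prop :=
  [/\ D a, forall b, S b -> le b a
    & forall c, D c -> (forall b, S b -> le b c) -> le a c].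

Definition directed (T : Type) (le : T -> T -> Prop) (S : set T) : Prop :=
  S !=set0 /\ forall a b, S a -> S b -> exists c, [/\ S c, le a c & le b c].

(* Positive normalised functionals on B(H) that preserve suprema of bounded
   increasing nets of positive operators; only the values at bounded operators
   matter. *)
Record normal_state (R : realType) (H : hilbert R)
    (omega : (H -> H) -> R[i]) : Prop := NormalState {
  state_linear : forall (a : R[i]) A B, bounded_op A -> bounded_op B ->
    omega (fun x => a *: A x + B x) = a * omega A + omega B;
  state_positive : forall A, positive_op A -> 0 <= omega A;
  state_unital : omega idfun = 1;
  state_normal : forall (S : set (H -> H)) A,
    S `<=` @positive_op R H -> directed (@op_le R H) S ->
    is_lub (@bounded_op R H) (@op_le R H) S A ->
    is_lub setT (fun a b : R[i] => a <= b) (omega @` S) (omega A) }.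

Definition faithful_state (R : realType) (H : hilbert R)
    (omega : (H -> H) -> R[i]) : Prop :=
  forall A, positive_op A -> omega A = 0 -> A = fun=> 0.

Section measure_type.
Context (R : realType) (H : arveson R) (G1 G2 : forall t, set (H t)).

Definition interval01 (p : R * R) : bool := [&& 0 <= p.1, p.1 < p.2 & p.2 <= 1].

(* mu = mu_omega *)
Definition state_law (omega : (H 1 -> H 1) -> R[i])
    (mu : probability (pair01 R) R) : Prop :=
  forall L1 L2 : seq (R * R), all interval01 L1 -> all interval01 L2 ->
  (fine (mu [set Z : pair01 R |
     closed01_set Z.1 `&` \bigcup_(p in [set` L1]) `[p.1, p.2]%classic = set0 /\
     closed01_set Z.2 `&` \bigcup_(p in [set` L2]) `[p.1, p.2]%classic = set0]))%:C =
  omega (proj_prod G1 L1 \o proj_prod G2 L2).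

Definition measure_type : set (probability (pair01 R) R) :=
  [set mu | exists omega (nu : probability (pair01 R) R),
     [/\ normal_state omega, faithful_state omega, state_law omega nu
       & nu `<< mu /\ mu `<< nu]].

End measure_type.

Definition Linfty (R : realType) d (T : measurableType d)
    (mu : {measure set T -> \bar R}) (f : T -> R[i]) : Prop :=
  (fun z => complex.Re (f z)) \in Lfun mu +oo%E /\
  (fun z => complex.Im (f z)) \in Lfun mu +oo%E.

Definition ae_le (R : realType) d (T : measurableType d)
    (mu : {measure set T -> \bar R}) (f g : T -> R[i]) : Prop :=
  \forall z \ae mu, f z <= g z.

(* J, given on representatives, is a normal *-isomorphism from L^oo(mu) onto
   its image, a unital subalgebra of B(H). *)
Record normal_star_iso (R : realType) d (T : measurableType d)
    (mu : {measure set T -> \bar R}) (H : hilbert R)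
    (J : (T -> R[i]) -> H -> H) : Prop := NormalStarIso {
  J_bounded : forall f, Linfty mu f -> bounded_op (J f);
  J_eq : forall f g, Linfty mu f -> Linfty mu g ->
    J f = J g <-> \forall z \ae mu, f z = g z;
  J_linear : forall (a : R[i]) f g, Linfty mu f -> Linfty mu g ->
    J (fun z => a * f z + g z) = (fun x => a *: J f x + J g x);
  J_mul : forall f g, Linfty mu f -> Linfty mu g ->
    J (fun z => f z * g z) = J f \o J g;
  J_unital : J (fun=> 1) = idfun;
  J_adjoint : forall f, Linfty mu f ->
    adjoint_ops (J f) (J (fun z => Num.conj (f z)));
  J_normal : forall (S : set (T -> R[i])) g,
    S `<=` [set f | Linfty mu f /\ ae_le mu (fun=> 0) f] ->
    directed (ae_le mu) S -> is_lub (Linfty mu) (ae_le mu) S g ->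
    is_lub (@bounded_op R H) (@op_le R H) (J @` S) (J g) }.

(* J = J_{G1,G2}, on L^oo(mu) for a representative mu of the measure type *)
Record is_J (R : realType) (H : arveson R) (G1 G2 : forall t, set (H t))
    (mu : probability (pair01 R) R)
    (J : (pair01 R -> R[i]) -> H 1 -> H 1) : Prop := IsJ {
  J_measure_type : measure_type G1 G2 mu;
  J_iso : normal_star_iso mu J;
  J_fst : forall s t, 0 <= s -> s < t -> t <= 1 ->
    J (\1_[set Z : pair01 R | closed01_set Z.1 `&` `[s, t] = set0]) =
    proj_op G1 s t;
  J_snd : forall s t, 0 <= s -> s < t -> t <= 1 ->
    J (\1_[set Z : pair01 R | closed01_set Z.2 `&` `[s, t] = set0]) =
    proj_op G2 s t }.

(* Main.v *)
Require Import Defs.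
From HB Require Import structures.
From mathcomp Require Import all_boot all_order all_algebra.
From mathcomp Require Import all_classical all_reals all_analysis.
From mathcomp Require Import complex measurable_realfun ess_sup_inf ring lra.

(** Let A_t be the closed span of u_t (x) F_t and E_t (x) v_t.  Since u and v are
units, A_{s+t} is contained in A_s (x) A_t, so the tensor products of 2^n copies of
A_{t/2^n} increase with n; let K_t be the closed span of their union.  On [s, t] the
projection of A is J of the event that Z_1 or Z_2 misses [s, t], because J turns
intersections into products and the two projections commute.  The n-th dyadic
approximation therefore corresponds to the event that each of the 2^n equal
subintervals misses Z_1 or Z_2.  By compactness the union of these events is
{Z_1 /\ Z_2 /\ [s, t] = 0}, and normality of J identifies J of that union with the
projection of K.  The events for [s, m] and [m, t] intersect in the one for [s, t],
which gives K_a (x) K_b = K_{a+b} when a + b <= 1, and then by halving in general.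
Thus K is a subsystem, and clearly the smallest one containing both
u (x) F and E (x) v. *)

Set Implicit Arguments.
Unset Strict Implicit.
Unset Printing Implicit Defensive.

Import Order.TTheory GRing.Theory Num.Theory.
Import numFieldNormedType.Exports.

Local Open Scope classical_set_scope.
Local Open Scope ring_scope.
Local Open Scope complex_scope.

(** * Hilbert spaces *)

Section inner_product.
Context (R : realType) (H : hilbert R).
Implicit Types (x y z : H) (a : R[i]).

Lemma ipDl x y z : ip (x + y) z = ip x z + ip y z.
Proof. exact: linearDl. Qed.

Lemma ipZl a x z : ip (a *: x) z = a * ip x z.
Proof. by rewrite /ip linearZl_LR. Qed.

Lemma ipBl x y z : ip (x - y) z = ip x z - ip y z.
Proof. exact: linearBl. Qed.

Lemma ip0l z : ip 0 z = 0.
Proof. exact: linear0l. Qed.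

Lemma ipDr x y z : ip x (y + z) = ip x y + ip x z.
Proof. exact: linearDr. Qed.

Lemma ipZr a x z : ip x (a *: z) = Num.conj a * ip x z.
Proof. by rewrite /ip linearZr_LR. Qed.

Lemma ipBr x y z : ip x (y - z) = ip x y - ip x z.
Proof. exact: linearBr. Qed.

Lemma ip0r z : ip z 0 = 0.
Proof. exact: linear0r. Qed.

Lemma ipC x y : ip x y = Num.conj (ip y x).
Proof. by rewrite /ip hermC expr0 mul1r. Qed.

Lemma ip_eq0C x y : ip x y = 0 -> ip y x = 0.
Proof. by move=> e; rewrite ipC e rmorph0. Qed.

Lemma ipxx x : ip x x = `|x| ^+ 2.
Proof. exact: hdotE. Qed.

Lemma ipxx_eq0 x : ip x x = 0 -> x = 0.
Proof. by rewrite ipxx => /eqP; rewrite sqrf_eq0 normr_eq0 => /eqP. Qed.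

Lemma ipxx_le0 x : ip x x <= 0 -> x = 0.
Proof.
move=> h; apply: ipxx_eq0; apply/eqP; rewrite eq_le h ipxx.
exact: exprn_ge0.
Qed.

Lemma ip_inj x y : (forall z, ip x z = ip y z) -> x = y.
Proof.
by move=> h; apply/eqP; rewrite -subr_eq0; apply/eqP/ipxx_eq0; rewrite ipBl h subrr.
Qed.

Lemma parallelogram x y :
  `|x + y| ^+ 2 + `|x - y| ^+ 2 = `|x| ^+ 2 *+ 2 + `|y| ^+ 2 *+ 2.
Proof.
rewrite -!ipxx ipBl ipDl !ipBr !ipDr; ring.
Qed.

(* The distance from [x] to the line of [y], scaled by the norm of [y]. *)
Lemma ip_defect x y :
  `|(`|y| ^+ 2) *: x - ip x y *: y| ^+ 2 =
  `|y| ^+ 2 * (`|x| ^+ 2 * `|y| ^+ 2 - `|ip x y| ^+ 2).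
Proof.
rewrite -[LHS]ipxx ipBl !ipBr !ipZl !ipZr !ipxx normCK -(ipC y x).
have -> : Num.conj (`|y| ^+ 2 : R[i]) = `|y| ^+ 2.
  by apply: conj_Creal; apply: ger0_real; apply: exprn_ge0.
ring.
Qed.

(** The left side of [ip_defect] is nonnegative; for nonzero [y] the factor |y|^2 cancels and square
    roots are taken. *)
Lemma cauchy_schwarz x y : `|ip x y| <= `|x| * `|y|.
Proof.
have [->|y0] := eqVneq y 0; first by rewrite ip0r !normr0 mulr0.
have y_gt0 : 0 < `|y| ^+ 2 by rewrite exprn_gt0// normr_gt0.
rewrite -(@ler_pXn2r _ 2)// ?nnegrE// ?mulr_ge0// exprMn.
have : 0 <= `|y| ^+ 2 * (`|x| ^+ 2 * `|y| ^+ 2 - `|ip x y| ^+ 2).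
  by rewrite -ip_defect exprn_ge0.
by rewrite pmulr_rge0// subr_ge0.
Qed.

Lemma ip_continuous y : continuous (fun x => ip x y : R[i]^o).
Proof.
move=> x; apply/cvgrPdist_lt => e e0.
near=> z.
rewrite -ipBl; apply: le_lt_trans (cauchy_schwarz _ _) _.
have y1 : 0 < `|y| + 1 by rewrite ltr_wpDl.
apply: (@le_lt_trans _ _ (`|x - z| * (`|y| + 1))).
  by rewrite ler_wpM2l// lerDl.
rewrite -ltr_pdivlMr//.
near: z; apply: cvgr_dist_lt => //; exact: divr_gt0.
Unshelve. all: by end_near. Qed.

End inner_product.

(** * Closed subspaces and closed spans *)

Section subspaces.
Context (R : realType).
Implicit Types H : hilbert R.

Lemma linear_bound_continuous (V W : normedModType R[i]) (f : V -> W) (c : R[i]) :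
  linear f -> (forall x, `|f x| <= c * `|x|) -> continuous f.
Proof.
move=> lf bf x; apply/cvgrPdist_lt => e e0.
(* The complex constant [c] need not be nonnegative, so the positive constant |c| + 1 replaces it;
   where [y] is nonzero, the bound itself forces c >= 0. *)
have c0 (y : V) : c * `|y| <= (`|c| + 1) * `|y|.
  have [->|y0] := eqVneq y 0; first by rewrite normr0 !mulr0.
  have yp : 0 < `|y| by rewrite normr_gt0.
  have : 0 <= c * `|y| by exact: le_trans (bf y).
  rewrite pmulr_lge0// => cp.
  by rewrite ger0_norm// ler_wpM2r// lerDl.
near=> z.
have -> : f x - f z = f (x - z).
  by have := lf (-1) z x; rewrite !scaleN1r [_ + x]addrC [_ + f x]addrC => ->.
apply: le_lt_trans (bf _) _; apply: le_lt_trans (c0 _) _.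
rewrite mulrC -ltr_pdivlMr ?ltr_wpDl//.
near: z; apply: cvgr_dist_lt => //; apply: divr_gt0 => //; by rewrite ltr_wpDl.
Unshelve. all: by end_near. Qed.

Lemma linear_fun0 (V W : lmodType R[i]) (f : V -> W) : linear f -> f 0 = 0.
Proof.
move=> lf; have := lf (-1) 0 0.
by rewrite scaleN1r oppr0 addr0 scaleN1r addNr.
Qed.

Lemma closed_singleton0 (V : normedModType R[i]) : closed [set (0 : V)].
Proof.
by apply: accessible_closed_set1; apply: hausdorff_accessible; exact: norm_hausdorff.
Qed.

Section one_space.
Context (H : hilbert R).
Implicit Types (V W X : set H) (x y : H).

Lemma subspace0 V : closed_subspace V -> V 0.
Proof. by case. Qed.

Lemma subspaceD V x y : closed_subspace V -> V x -> V y -> V (x + y).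
Proof. by move=> [_ _ h] vx vy; have := h 1 _ _ vx vy; rewrite scale1r. Qed.

Lemma subspaceZ V (a : R[i]) x : closed_subspace V -> V x -> V (a *: x).
Proof. by move=> [_ v0 h] vx; have := h a _ _ vx v0; rewrite addr0. Qed.

Lemma subspaceB V x y : closed_subspace V -> V x -> V y -> V (x - y).
Proof.
move=> cV vx vy; apply: subspaceD => //.
by rewrite -scaleN1r; apply: subspaceZ.
Qed.

Lemma closed_subspaceT : closed_subspace [set: H].
Proof. by split => //; exact: closedT. Qed.

Lemma closed_span_subspace X : closed_subspace (closed_span X).
Proof.
split.
- by apply: closed_bigI => V [[cV _ _] _].
- by move=> V [[]].
- by move=> a x y hx hy V hV; case: (hV) => -[_ _ h] _; apply: h; [exact: hx|exact: hy].
Qed.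

Lemma sub_closed_span X : X `<=` closed_span X.
Proof. by move=> x Xx V [_]; apply. Qed.

Lemma closed_span_min X V : closed_subspace V -> X `<=` V -> closed_span X `<=` V.
Proof. by move=> cV XV x; apply. Qed.

Lemma closed_span_id V : closed_subspace V -> closed_span V = V.
Proof.
move=> cV; apply/seteqP; split; first exact: closed_span_min.
exact: sub_closed_span.
Qed.

Lemma closed_spanS X Y : X `<=` closed_span Y -> closed_span X `<=` closed_span Y.
Proof. by move=> XY; apply: closed_span_min => //; exact: closed_span_subspace. Qed.

Lemma orthogonal_subspace X : closed_subspace [set x | forall y, X y -> ip x y = 0].
Proof.
split.
- have -> : [set x | forall y, X y -> ip x y = 0] =
      \bigcap_(y in X) ((fun x => ip x y : R[i]^o) @^-1` [set 0]) by [].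
  apply: closed_bigI => y _; apply: closed_comp; last exact: closed_singleton0.
  by move=> x _; apply: ip_continuous.
- by move=> y _; rewrite ip0l.
- by move=> a x y hx hy z Xz; rewrite ipDl ipZl hx// hy// mulr0 addr0.
Qed.

Lemma orthogonal_span X x :
  (forall y, X y -> ip x y = 0) -> forall y, closed_span X y -> ip x y = 0.
Proof.
move=> h y hy; apply: ip_eq0C.
(* The orthogonal complement of [x] is a closed subspace containing [X]. *)
suff : closed_span X `<=` [set z | forall w, [set x] w -> ip z w = 0] by move=> /(_ _ hy); apply.
apply: closed_span_min; first exact: orthogonal_subspace.
by move=> z Xz _ ->; apply: ip_eq0C; exact: h.
Qed.

End one_space.

Lemma preimage_subspace H1 H2 (f : H1 -> H2) (V : set H2) :
  linear f -> continuous f -> closed_subspace V -> closed_subspace (f @^-1` V).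
Proof.
move=> lf cf [cV v0 hV]; split.
- by apply: closed_comp => // x _; exact: cf.
- by rewrite /= (linear_fun0 lf).
- by move=> a x y hx hy; rewrite /= lf; exact: hV.
Qed.

Lemma equalizer_subspace H1 H2 (f g : H1 -> H2) :
  linear f -> continuous f -> linear g -> continuous g ->
  closed_subspace [set x | f x = g x].
Proof.
move=> lf cf lg cg.
have -> : [set x | f x = g x] = (fun x => f x - g x) @^-1` [set 0].
  apply/seteqP; split => x /=; first by move->; rewrite subrr.
  by move=> /eqP; rewrite subr_eq0 => /eqP.
apply: preimage_subspace.
- by move=> a x y /=; rewrite lf lg scalerBr opprD addrACA.
- by move=> x; apply: cvgB; [exact: cf|exact: cg].
- split => //; first exact: closed_singleton0.
  by move=> a x y /= -> ->; rewrite scaler0 addr0.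
Qed.

End subspaces.

(** * Orthogonal projection onto a closed subspace *)

Section projection.
Context (R : realType) (H : hilbert R).
Implicit Types (V W X : set H) (x y : H).

Local Notation rnorm x := (complex.Re `|x|).

Lemma rnormE x : `|x| = (rnorm x)%:C.
Proof. by rewrite RRe_real// normr_real. Qed.

Lemma norm2E x : `|x| ^+ 2 = (rnorm x ^+ 2)%:C.
Proof. by rewrite {1}rnormE rmorphXn. Qed.

Lemma rnorm_ge0 x : 0 <= rnorm x.
Proof. by rewrite -ler0c -rnormE. Qed.

Lemma rnorm_parallelogram x y :
  rnorm (x + y) ^+ 2 + rnorm (x - y) ^+ 2 = rnorm x ^+ 2 *+ 2 + rnorm y ^+ 2 *+ 2.
Proof.
by move: (parallelogram x y); rewrite !norm2E !mulr2n -!rmorphD => /complexI.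
Qed.

Lemma rnorm_double x : rnorm (2 *: x) ^+ 2 = 4 * rnorm x ^+ 2.
Proof.
apply: complexI; rewrite [RHS]rmorphM /= -!norm2E normrZ exprMn normr_nat rmorph_nat.
by rewrite -natrX.
Qed.

(* By [ip_defect], approximate minimality of the distance forces approximate orthogonality. *)
Lemma near_min_orthogonal V x y (d e : R) : closed_subspace V ->
  (forall z, V z -> d <= rnorm (x - z) ^+ 2) -> V y -> rnorm (x - y) ^+ 2 <= d + e ->
  forall z, V z -> `|ip (x - y) z| ^+ 2 <= e%:C * `|z| ^+ 2.
Proof.
move=> cV dV Vy ye z Vz.
have [->|z0] := eqVneq z 0; first by rewrite ip0r !normr0 expr0n mulr0.
have z_gt0 : 0 < `|z| ^+ 2 by rewrite exprn_gt0// normr_gt0.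
have := ip_defect (x - y) z.
set c := ip (x - y) z; set w := _ *: _ - _ => wE.
(* This competitor adds to [y] the component of [x - y] along [z]; its squared distance from [x] is
   |x - y|^2 - |c|^2 / |z|^2, which is still at least [d]. *)
have Vw : V (y + (`|z| ^- 2 * c) *: z) by apply: subspaceD => //; exact: subspaceZ.
have wE' : `|z| ^- 2 *: w = x - (y + (`|z| ^- 2 * c) *: z).
  by rewrite /w scalerBr scalerA mulVf ?gt_eqF// scale1r scalerA opprD addrA.
have := dV _ Vw; rewrite -wE' => h.
have {}h : d%:C <= `|z| ^- 2 * (`|x - y| ^+ 2 * `|z| ^+ 2 - `|c| ^+ 2).
  have -> : `|z| ^- 2 * (`|x - y| ^+ 2 * `|z| ^+ 2 - `|c| ^+ 2) =
     `|(`|z| ^- 2 *: w)| ^+ 2.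
    rewrite normrZ exprMn wE normfV normrX normr_id -exprVn; field.
    by rewrite normr_eq0.
  by rewrite [X in _ <= X]norm2E lecR.
have : d%:C * `|z| ^+ 2 <= `|x - y| ^+ 2 * `|z| ^+ 2 - `|c| ^+ 2.
  by rewrite -ler_pdivlMr// mulrC.
have : `|x - y| ^+ 2 <= d%:C + e%:C.
  by rewrite norm2E -rmorphD lecR.
move=> /(ler_wpM2r (ltW z_gt0)) h1 h2.
have := lerD h1 h2; rewrite -subr_ge0 => h3.
rewrite -subr_ge0; apply: le_trans h3 _; rewrite le_eqVlt; apply/orP; left.
by apply/eqP; ring.
Qed.

(** The parallelogram law for [x - y] and [x - y']: the midpoint of [y] and [y'] lies in [V], hence
    at squared distance at least [d] from [x]. *)
Lemma near_min_close V x y y' (d e e' : R) : closed_subspace V ->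
  (forall z, V z -> d <= rnorm (x - z) ^+ 2) ->
  V y -> rnorm (x - y) ^+ 2 <= d + e -> V y' -> rnorm (x - y') ^+ 2 <= d + e' ->
  rnorm (y - y') ^+ 2 <= (e + e') *+ 2.
Proof.
move=> cV dV Vy ye Vy' ye'.
have := rnorm_parallelogram (x - y) (x - y').
have -> : x - y + (x - y') = 2 *: (x - (2^-1 *: (y + y'))).
  rewrite scalerBr scalerA mulfV// scale1r scaler_nat mulr2n opprD.
  by rewrite addrACA.
have -> : x - y - (x - y') = - (y - y').
  by rewrite !opprB addrC addrA subrK addrC.
have /dV : V (2^-1 *: (y + y')) by apply: subspaceZ => //; exact: subspaceD.
rewrite normrN rnorm_double => dm h.
lra.
Qed.

(** A sequence in [V] minimising the distance to [x] is Cauchy by [near_min_close]. Its limit [p]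
    lies in [V], and [near_min_orthogonal] passes to the limit, making [x - p] orthogonal to [V]. *)
Theorem projection_exists V x : closed_subspace V ->
  exists p, V p /\ forall y, V y -> ip (x - p) y = 0.
Proof.
move=> cV.
pose D := [set rnorm (x - y) ^+ 2 | y in V].
have hD : has_inf D.
  split; first by exists (rnorm (x - 0) ^+ 2), 0 => //; exact: subspace0.
  by exists 0 => _ [y _ <-]; exact: sqr_ge0.
have dV z : V z -> inf D <= rnorm (x - z) ^+ 2.
  by move=> Vz; apply: ge_inf; [case: hD|exists z].
have /choice[y yP] n : exists y, V y /\ rnorm (x - y) ^+ 2 <= inf D + n.+1%:R^-1.
  have [_ [y Vy <-] yn] := @inf_adherent _ D n.+1%:R^-1 (ltac:(by rewrite invr_gt0)) hD.
  by exists y; split => //; exact: ltW.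
have Vy n : V (y n) by case: (yP n).
have yd n : rnorm (x - y n) ^+ 2 <= inf D + n.+1%:R^-1 by case: (yP n).
have small (e : R) : 0 < e -> \forall n \near \oo, n.+1%:R^-1 < e.
  by move=> e0; near=> n; near: n; apply: near_infty_natSinv_lt (PosNum e0).
have : cauchy (y @ \oo).
  apply: cauchy_exP => e e0.
  have er : e = (complex.Re e)%:C by rewrite RRe_real// gtr0_real.
  have re0 : 0 < complex.Re e by rewrite -ltcR -er.
  (* With tolerance e^2/4 for both points, the bound of [near_min_close] is exactly e^2. *)
  have e4 : 0 < complex.Re e ^+ 2 / 4 by rewrite divr_gt0// exprn_gt0.
  have [N _ hN] := small _ e4.
  exists (y N).
  exists N => // n /= Nn.
  rewrite -ball_normE /= er rnormE ltcR.
  rewrite -(@ltr_pXn2r _ 2)// ?nnegrE ?rnorm_ge0 ?(ltW re0)//.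
  apply: le_lt_trans (near_min_close cV dV (Vy N) (yd N) (Vy n) (yd n)) _.
  have -> : complex.Re e ^+ 2 = (complex.Re e ^+ 2 / 4 + complex.Re e ^+ 2 / 4) *+ 2 by field.
  by rewrite ltr_pMn2r// ltrD//; [exact: hN N (leqnn N)|exact: hN n Nn].
move=> /cauchy_cvg /cvg_ex[p yp].
exists p; split.
  have [clV _ _] := cV.
  by apply: (@closed_cvg _ _ _ _ y V clV _ p yp); exact: nearW.
move=> z Vz.
have c1 : (fun n => ip (x - y n) z : R[i]^o) @ \oo --> (ip (x - p) z : R[i]^o).
  apply: (@cvg_comp _ _ _ (fun n => x - y n) (fun w => ip w z : R[i]^o)); last exact: ip_continuous.
  by apply: cvgB => //; exact: cvg_cst.
have c0 : (fun n => ip (x - y n) z : R[i]^o) @ \oo --> (0 : R[i]^o).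
  apply/cvgr0Pnorm_lt => e e0.
  have er : e = (complex.Re e)%:C by rewrite RRe_real// gtr0_real.
  have re0 : 0 < complex.Re e by rewrite -ltcR -er.
  (* The summand 1 keeps the divisor positive when [z] is zero. *)
  have z1 : 0 < rnorm z ^+ 2 + 1 by rewrite ltr_wpDl// sqr_ge0.
  have e4 : 0 < complex.Re e ^+ 2 / (rnorm z ^+ 2 + 1) by rewrite divr_gt0// exprn_gt0.
  have := small _ e4; apply: filterS => n hn.
  rewrite -(@ltr_pXn2r _ 2)// ?nnegrE ?(ltW e0)//.
  apply: le_lt_trans (near_min_orthogonal cV dV (Vy n) (yd n) Vz) _.
  rewrite norm2E er -rmorphM -rmorphXn ltcR.
  apply: (@le_lt_trans _ _ (n.+1%:R^-1 * (rnorm z ^+ 2 + 1))).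
    by rewrite ler_wpM2l ?invr_ge0// lerDl.
  by rewrite -ltr_pdivlMr.
exact: (cvg_unique _ c1 c0).
Unshelve. all: by end_near. Qed.

End projection.

Section orth_proj_theory.
Context (R : realType) (H : hilbert R) (V : set H).
Hypothesis cV : closed_subspace V.
Implicit Types x y p : H.

Lemma orth_projP x : V (orth_proj V x) /\ forall y, V y -> ip (x - orth_proj V x) y = 0.
Proof. exact: getPex (projection_exists x cV). Qed.

Lemma orth_proj_mem x : V (orth_proj V x).
Proof. by case: (orth_projP x). Qed.

Lemma orth_proj_ip x y : V y -> ip (orth_proj V x) y = ip x y.
Proof.
by move=> Vy; case: (orth_projP x) => _ /(_ _ Vy) /eqP; rewrite ipBl subr_eq0 => /eqP.
Qed.

Lemma orth_proj_uniq x p :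
  V p -> (forall y, V y -> ip p y = ip x y) -> orth_proj V x = p.
Proof.
move=> Vp hp; apply/eqP; rewrite -subr_eq0; apply/eqP; apply: ipxx_eq0.
have Vd : V (orth_proj V x - p) by apply: subspaceB => //; exact: orth_proj_mem.
by rewrite {1}ipBl orth_proj_ip// hp// subrr.
Qed.

Lemma orth_proj_id x : V x -> orth_proj V x = x.
Proof. by move=> Vx; exact: orth_proj_uniq. Qed.

Lemma orth_proj_eq0 x : (forall y, V y -> ip x y = 0) -> orth_proj V x = 0.
Proof.
by move=> h; apply: orth_proj_uniq => [|y Vy]; [exact: subspace0|rewrite ip0l h].
Qed.

Lemma orth_proj_linear : linear (orth_proj V).
Proof.
move=> a x y; apply: orth_proj_uniq.
  by apply: subspaceD => //; [apply: subspaceZ => //|]; exact: orth_proj_mem.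
by move=> z Vz; rewrite !ipDl !ipZl !orth_proj_ip.
Qed.

Lemma orth_proj_norm x : ip (orth_proj V x) x = `|orth_proj V x| ^+ 2.
Proof. by rewrite ipC -(orth_proj_ip _ (orth_proj_mem _)) -ipC ipxx. Qed.

(** Writing P for the projection, |Px|^2 = <Px, x> <= |Px| |x| by Cauchy-Schwarz. *)
Lemma orth_proj_le x : `|orth_proj V x| <= `|x|.
Proof.
have [->|p0] := eqVneq (orth_proj V x) 0; first by rewrite normr0.
have p_gt0 : 0 < `|orth_proj V x| by rewrite normr_gt0.
rewrite -(ler_pM2l p_gt0) -expr2 -orth_proj_norm.
rewrite -[ip _ _]ger0_norm; first exact: cauchy_schwarz.
by rewrite orth_proj_norm exprn_ge0.
Qed.

Lemma orth_proj_bounded_op : bounded_op (orth_proj V).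
Proof.
split; first exact: orth_proj_linear.
apply: (linear_bound_continuous (c := 1)); first exact: orth_proj_linear.
by move=> x; rewrite mul1r orth_proj_le.
Qed.

End orth_proj_theory.

(** Projecting to [W] first does not change the projection to [V], so the latter has the smaller
    norm; the quadratic forms are the squares of these norms. *)
Lemma orth_proj_mono (R : realType) (H : hilbert R) (V W : set H) :
  closed_subspace V -> closed_subspace W -> V `<=` W -> op_le (orth_proj V) (orth_proj W).
Proof.
move=> cV cW VW x; rewrite !orth_proj_norm//.
have <- : orth_proj V (orth_proj W x) = orth_proj V x.
  apply: orth_proj_uniq => //; first exact: orth_proj_mem.
  by move=> y Vy; rewrite !orth_proj_ip//; exact: VW.
by rewrite lerXn2r ?nnegrE ?normr_ge0// orth_proj_le.
Qed.

Section bounded_ops.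
Context (R : realType) (H : hilbert R).

Lemma bounded_op_comp (A B : H -> H) : bounded_op A -> bounded_op B -> bounded_op (A \o B).
Proof.
move=> [lA cA] [lB cB]; split; first by move=> a x y /=; rewrite lB lA.
by move=> x; apply: continuous_comp; [exact: cB|exact: cA].
Qed.

Lemma bounded_op_eq_on_span (A B : H -> H) (X : set H) :
  bounded_op A -> bounded_op B -> closed_span X = [set: H] ->
  (forall x, X x -> A x = B x) -> A = B.
Proof.
move=> [lA cA] [lB cB] XT h; apply/funext => x.
have : closed_span X x by rewrite XT.
by apply: (@closed_span_min _ _ X [set x | A x = B x]) => //; exact: equalizer_subspace.
Qed.

End bounded_ops.

(** * Tensor products of subspaces *)

Section tensors.
Context (R : realType) (U V W : hilbert R) (m : {bilinear U -> V -> W}).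
Hypothesis mip : forall x x' y y', ip (m x y) (m x' y') = ip x x' * ip y y'.
Implicit Types (X : set U) (Y : set V).

Lemma tensor_norm x y : `|m x y| = `|x| * `|y|.
Proof.
apply/eqP; rewrite -(@eqrXn2 _ 2)// ?mulr_ge0//.
by rewrite exprMn -!ipxx mip.
Qed.

Lemma tensor_linearl y : linear (fun x => m x y).
Proof. by move=> a x x' /=; rewrite linearPl. Qed.

Lemma tensor_linearr x : linear (m x).
Proof. by move=> a y y' /=; rewrite linearPr. Qed.

Lemma tensor_continuousl y : continuous (fun x => m x y).
Proof.
apply: (linear_bound_continuous (c := `|y|)); first exact: tensor_linearl.
by move=> x; rewrite tensor_norm mulrC.
Qed.

Lemma tensor_continuousr x : continuous (m x).
Proof.
apply: (linear_bound_continuous (c := `|x|)); first exact: tensor_linearr.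
by move=> y; rewrite tensor_norm.
Qed.

(** With one argument fixed, the preimage of [Z] is a closed subspace, so the two arguments pass to
    closed spans one after the other. *)
Lemma closed_span_tensor_min X Y (Z : set W) : closed_subspace Z ->
  (forall x y, X x -> Y y -> Z (m x y)) ->
  forall x y, closed_span X x -> closed_span Y y -> Z (m x y).
Proof.
move=> cZ h x y + Yy; move: x.
apply: (@closed_span_min _ _ X ((fun x => m x y) @^-1` Z)).
  by apply: preimage_subspace => //; [exact: tensor_linearl|exact: tensor_continuousl].
move=> x Xx; move: y Yy; apply: (@closed_span_min _ _ Y (m x @^-1` Z)).
  by apply: preimage_subspace => //; [exact: tensor_linearr|exact: tensor_continuousr].
by move=> y Yy; exact: h.
Qed.

Lemma closed_span_tensor X Y :
  closed_span [set m x y | x in closed_span X & y in closed_span Y] =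
  closed_span [set m x y | x in X & y in Y].
Proof.
apply/seteqP; split; apply: closed_spanS => _ [x Xx [y Yy <-]].
  apply: (closed_span_tensor_min (closed_span_subspace _) _ Xx Yy) => x' y' Xx' Yy'.
  by apply: sub_closed_span; exists x' => //; exists y'.
by apply: sub_closed_span; exists x; [exact: sub_closed_span|exists y; [exact: sub_closed_span|]].
Qed.

Lemma orth_proj_tensor X Y x y : closed_subspace X -> closed_subspace Y ->
  orth_proj (closed_span [set m x y | x in X & y in Y]) (m x y) =
  m (orth_proj X x) (orth_proj Y y).
Proof.
move=> cX cY; apply: orth_proj_uniq; first exact: closed_span_subspace.
  apply: sub_closed_span; exists (orth_proj X x); first exact: orth_proj_mem.
  by exists (orth_proj Y y) => //; exact: orth_proj_mem.
move=> z /[dup] _ hz; apply/eqP; rewrite -subr_eq0 -ipBl; apply/eqP.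
apply: orthogonal_span hz => _ [x' Xx' [y' Yy' <-]].
by rewrite ipBl !mip !orth_proj_ip// subrr.
Qed.

End tensors.

(** * Product systems *)

Section product_system.
Context (R : realType) (H : arveson R).
Implicit Types r s t : R.

(** The copy of [X (x) Y] in the fibre at [r]; keeping [e] as a parameter avoids transports between
    fibres at equal times. *)
Definition tens s t r (e : s + t = r) (X : set (H s)) (Y : set (H t)) : set (H r) :=
  closed_span [set amul e x y | x in X & y in Y].

Lemma amul_ip s t r (e : s + t = r) : 0 <= s -> 0 <= t ->
  forall x x' y y', ip (amul (E := H) e x y) (amul e x' y') = ip x x' * ip y y'.
Proof. by move=> s0 t0; case: (arveson_unitary H e s0 t0). Qed.

Lemma amul_total s t r (e : s + t = r) : 0 <= s -> 0 <= t ->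
  tens e setT setT = setT.
Proof. by move=> s0 t0; case: (arveson_unitary H e s0 t0). Qed.

Lemma tens_subspace s t r (e : s + t = r) X Y : closed_subspace (tens e X Y).
Proof. exact: closed_span_subspace. Qed.

Lemma mem_tens s t r (e : s + t = r) (X : set (H s)) (Y : set (H t)) x y :
  X x -> Y y -> tens e X Y (amul e x y).
Proof. by move=> Xx Yy; apply: sub_closed_span; exists x => //; exists y. Qed.

Lemma tensS s t r (e : s + t = r) (X X' : set (H s)) (Y Y' : set (H t)) :
  X `<=` X' -> Y `<=` Y' -> tens e X Y `<=` tens e X' Y'.
Proof.
move=> XX YY; apply: closed_spanS => _ [x Xx [y Yy <-]].
by apply: mem_tens; [exact: XX|exact: YY].
Qed.

Lemma tens_min s t r (e : s + t = r) (X : set (H s)) (Y : set (H t)) (Z : set (H r)) :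
  closed_subspace Z -> (forall x y, X x -> Y y -> Z (amul e x y)) -> tens e X Y `<=` Z.
Proof. by move=> cZ h; apply: closed_span_min => // _ [x Xx [y Yy <-]]; exact: h. Qed.

(** Both sides are the closed span of the triple products: writing [X] and [Z] as their own closed
    spans lets [closed_span_tensor] remove the inner closures. *)
Lemma tens_assoc r s t rs st q (e1 : r + s = rs) (e2 : rs + t = q)
    (e3 : s + t = st) (e4 : r + st = q) (X : set (H r)) (Y : set (H s)) (Z : set (H t)) :
  0 <= r -> 0 <= s -> 0 <= t -> closed_subspace X -> closed_subspace Z ->
  tens e2 (tens e1 X Y) Z = tens e4 X (tens e3 Y Z).
Proof.
move=> r0 s0 t0 cX cZ.
have rs0 : 0 <= rs by rewrite -e1 addr_ge0.
have st0 : 0 <= st by rewrite -e3 addr_ge0.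
rewrite /tens -{1}(closed_span_id cZ) closed_span_tensor; last exact: amul_ip.
rewrite -{2}(closed_span_id cX) closed_span_tensor; last exact: amul_ip.
congr closed_span; apply/seteqP; split.
  move=> _ [_ [x Xx [y Yy <-]] [z Zz <-]]; exists x => //.
  by exists (amul e3 y z); [exists y => //; exists z|rewrite (arveson_assoc e1 e2 e3 e4)].
move=> _ [x Xx [_ [y Yy [z Zz <-]] <-]]; exists (amul e1 x y).
  by exists x => //; exists y.
by exists z => //; rewrite (arveson_assoc e1 e2 e3 e4).
Qed.

(** * Operators of the form [1 (x) Pr (x) 1] on the fibre at time 1 *)

Section three_factors.
Context s t (s0 : 0 <= s) (st : s <= t) (t1 : t <= 1).

Let ts0 : 0 <= t - s. Proof. by rewrite subr_ge0. Qed.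
Let t0 : 0 <= t. Proof. exact: le_trans st. Qed.
Let t1' : 0 <= 1 - t. Proof. by rewrite subr_ge0. Qed.

Lemma amul3_ip x x' y y' z z' :
  ip (@amul3 _ H s t x y z) (amul3 x' y' z') = ip x x' * ip y y' * ip z z'.
Proof. by rewrite /amul3 !amul_ip. Qed.

Lemma amul3_eq0 x y z : x != 0 -> z != 0 -> @amul3 _ H s t x y z = 0 -> y = 0.
Proof.
move=> x0 z0 e; apply: ipxx_eq0; have := amul3_ip x x y y z z.
rewrite e ip0l => /esym/eqP; rewrite !mulf_eq0 !ipxx !sqrf_eq0 !normr_eq0.
by rewrite (negbTE x0) (negbTE z0) orbF => /eqP ->; rewrite normr0 expr0n.
Qed.

Lemma amul3_linear x z : linear (fun y => @amul3 _ H s t x y z).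
Proof. by move=> a y y'; rewrite /amul3 linearPr linearPl. Qed.

Lemma amul3_continuous x z : continuous (fun y => @amul3 _ H s t x y z).
Proof.
move=> y.
apply: (@continuous_comp _ _ _ (amul (subrKC s t) x) (fun w => amul (subrKC t 1) w z)).
  by apply: tensor_continuousr => *; exact: amul_ip.
by apply: tensor_continuousl => *; exact: amul_ip.
Qed.

Lemma amul3_fixed_subspace (A : H 1 -> H 1) x z : bounded_op A ->
  closed_subspace [set y | A (@amul3 _ H s t x y z) = amul3 x y z].
Proof.
move=> [lA cA]; apply: (@equalizer_subspace _ _ _ (A \o (fun y => amul3 x y z))).
- by move=> k y1 y2; rewrite /= amul3_linear lA.
- by move=> y; apply: continuous_comp; [exact: amul3_continuous|exact: cA].
- exact: amul3_linear.
- exact: amul3_continuous.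
Qed.

(** This is [H_s (x) X (x) H_{1-t}] inside [H_1]. *)
Definition amul3_span (X : set (H (t - s))) : set (H 1) :=
  closed_span [set w | exists x y z, X y /\ w = amul3 x y z].

Lemma amul3_total (X : set (H (t - s))) : closed_span X = setT -> amul3_span X = setT.
Proof.
move=> XT; apply/seteqP; split => // w _.
have cZ : closed_subspace (amul3_span X) by exact: closed_span_subspace.
have : tens (subrKC t 1) setT setT w by rewrite amul_total.
apply: tens_min => // v z _ _.
have : tens (subrKC s t) setT setT v by rewrite amul_total.
apply: (@tens_min _ _ _ _ _ _ ((fun v => amul (subrKC t 1) v z) @^-1` amul3_span X)).
  apply: preimage_subspace => //; first exact: tensor_linearl.
  by apply: tensor_continuousl => *; exact: amul_ip.
move=> x y _ _; have : closed_span X y by rewrite XT.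
apply: (@closed_span_min _ _ X ((fun y => amul3 x y z) @^-1` amul3_span X)).
  apply: preimage_subspace => //; first exact: amul3_linear.
  exact: amul3_continuous.
by move=> {}y Xy; apply: sub_closed_span; exists x, y, z.
Qed.

Context (V : set (H (t - s))) (cV : closed_subspace V).

Lemma orth_proj_amul3 x y z :
  orth_proj (amul3_span V) (amul3 x y z) = amul3 x (orth_proj V y) z.
Proof.
apply: orth_proj_uniq; first exact: closed_span_subspace.
  by apply: sub_closed_span; exists x, (orth_proj V y), z; split=> //; exact: orth_proj_mem.
move=> w hw; apply/eqP; rewrite -subr_eq0 -ipBl; apply/eqP.
apply: orthogonal_span hw => _ [x' [y' [z' [Vy' ->]]]].
by rewrite ipBl !amul3_ip orth_proj_ip// subrr.
Qed.

Lemma orth_proj_amul3_span_uniq (A : H 1 -> H 1) (Y : set (H (t - s))) : bounded_op A ->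
  closed_span Y = setT ->
  (forall x y z, Y y -> A (amul3 x y z) = amul3 x (orth_proj V y) z) ->
  A = orth_proj (amul3_span V).
Proof.
move=> bA YT h; apply: (bounded_op_eq_on_span bA _ (amul3_total YT)).
  by apply: orth_proj_bounded_op; exact: closed_span_subspace.
by move=> _ [x [y [z [Yy ->]]]]; rewrite h// orth_proj_amul3.
Qed.

(** The criterion by which images under [J] are recognised as projections: split the middle factor
    into its components in [V] and orthogonal to [V]. *)
Lemma orth_proj_amul3_spanP (A : H 1 -> H 1) : bounded_op A ->
  (forall x y z, V y -> A (amul3 x y z) = amul3 x y z) ->
  (forall x y z, (forall y', V y' -> ip y y' = 0) -> A (amul3 x y z) = 0) ->
  A = orth_proj (amul3_span V).
Proof.
move=> bA fixV killV; apply: (orth_proj_amul3_span_uniq (Y := setT)) => //.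
  by rewrite closed_span_id//; exact: closed_subspaceT.
move=> x y z _; have [lA _] := bA.
have Py := orth_proj_mem cV y.
have -> : y = 1 *: (y - orth_proj V y) + orth_proj V y by rewrite scale1r subrK.
rewrite amul3_linear lA killV; last by move=> y' Vy'; case: (orth_projP cV y) => _; apply.
by rewrite scaler0 add0r scale1r subrK fixV.
Qed.

(** [get] picks some bounded operator with prescribed values on the tensors [amul3]; the projection
    shows that one exists, and totality of these tensors that it is unique. *)
Lemma proj_opE (G : forall t, set (H t)) : G _ = V -> proj_op G s t = orth_proj (amul3_span V).
Proof.
move=> GV; rewrite /proj_op GV; set P := [set A | _].
have /getPex[bA hA] : exists A, P A.
  exists (orth_proj (amul3_span V)); split; last exact: orth_proj_amul3.
  by apply: orth_proj_bounded_op; exact: closed_span_subspace.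
apply: (orth_proj_amul3_span_uniq (Y := setT)) => //.
by rewrite closed_span_id//; exact: closed_subspaceT.
Qed.

End three_factors.

(** By associativity [x (x) y1 (x) y2 (x) z] is a triple tensor for [m, t] with first factor [x y1],
    and one for [s, m] with last factor [y2 z]. The two projections thus act on separate factors. *)
Lemma amul3_span_comp s m t (e : (m - s) + (t - m) = t - s)
    (V1 : set (H (m - s))) (V2 : set (H (t - m))) :
  0 <= s -> s <= m -> m <= t -> t <= 1 -> closed_subspace V1 -> closed_subspace V2 ->
  orth_proj (amul3_span V1) \o orth_proj (amul3_span V2) =
  orth_proj (amul3_span (tens e V1 V2)).
Proof.
move=> s0 sm mt t1 cV1 cV2.
have m0 : 0 <= m by exact: le_trans sm.
have t0 : 0 <= t by exact: le_trans mt.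
have m1 : m <= 1 by exact: le_trans t1.
have st : s <= t by exact: le_trans mt.
have sm' : 0 <= m - s by rewrite subr_ge0.
have mt' : 0 <= t - m by rewrite subr_ge0.
have t1' : 0 <= 1 - t by rewrite subr_ge0.
apply: (orth_proj_amul3_span_uniq s0 st t1 _ _ (amul_total e sm' mt')) => //.
- exact: tens_subspace.
- by apply: bounded_op_comp; apply: orth_proj_bounded_op; exact: closed_span_subspace.
move=> x _ z [y1 _ [y2 _ <-]].
have e3 : (t - m) + (1 - t) = 1 - m by rewrite addrC subrKA.
have split1 x' y1' y2' : @amul3 _ H s t x' (amul e y1' y2') z =
    amul3 (amul (subrKC s m) x' y1') y2' z.
  by rewrite /amul3 (arveson_assoc (subrKC s m) (subrKC m t) e (subrKC s t)).
have split2 x' y1' y2' z' : @amul3 _ H m t (amul (subrKC s m) x' y1') y2' z' =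
    amul3 x' y1' (amul e3 y2' z').
  by rewrite /amul3 (arveson_assoc (subrKC m t) (subrKC t 1) e3 (subrKC m 1)).
rewrite split1 /= orth_proj_amul3// split2 orth_proj_amul3// -split2 -split1.
by rewrite /tens orth_proj_tensor//; exact: amul_ip.
Qed.

(** Nonzero outer factors can be cancelled by [amul3_eq0], which recovers the projection onto [V],
    and hence [V], from [1 (x) Pr_V (x) 1]. *)
Lemma amul3_span_inj s t (V V' : set (H (t - s))) : 0 <= s -> s <= t -> t <= 1 ->
  closed_subspace V -> closed_subspace V' ->
  (exists x : H s, x != 0) -> (exists z : H (1 - t), z != 0) ->
  orth_proj (amul3_span V) = orth_proj (amul3_span V') -> V = V'.
Proof.
move=> s0 st t1 cV cV' [x x0] [z z0] e.
have PE y : orth_proj V y = orth_proj V' y.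
  apply/eqP; rewrite -subr_eq0; apply/eqP; apply: (amul3_eq0 s0 st t1 x0 z0).
  rewrite addrC.
  have := amul3_linear x z (-1) (orth_proj V' y) (orth_proj V y).
  rewrite /= !scaleN1r => ->.
  by rewrite -!(orth_proj_amul3 s0 st t1)// e addNr.
by apply/seteqP; split => y Vy; [rewrite -(orth_proj_id cV Vy) PE|
  rewrite -(orth_proj_id cV' Vy) -PE]; exact: orth_proj_mem.
Qed.

End product_system.

(** * Limits of dyadic tensor powers *)

Section dyadic_limit.
Context (R : realType) (H : arveson R) (A : forall t, set (H t)).
Arguments A : clear implicits.
Implicit Types a b c s t : R.

Definition halves t : t / 2 + t / 2 = t := esym (splitr t).

(** The tensor product of [2 ^ n] copies of [A] at time [t / 2 ^ n], bracketed as a binary tree. *)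
Fixpoint dyadic (n : nat) (t : R) : set (H t) :=
  if n is n'.+1 then tens (halves t) (@dyadic n' (t / 2)) (@dyadic n' (t / 2))
  else A t.
Arguments dyadic : clear implicits.

Definition dyadic_limit t : set (H t) := closed_span (\bigcup_n dyadic n t).
Arguments dyadic_limit : clear implicits.

(** Differences such as [m - s] and [t - m] equal [t / 2] only provably, hence the free equation
    [e]; all proofs of an equation in [R] coincide. *)
Lemma dyadicSE n a b t (e : a + b = t) : a = t / 2 -> b = t / 2 ->
  dyadic n.+1 t = tens e (dyadic n a) (dyadic n b).
Proof. by move=> ea eb; subst a b; rewrite (eq_irrelevance e (halves t)). Qed.

Lemma half_ge0 t : 0 <= t -> 0 <= t / 2.
Proof. by move=> t0; rewrite divr_ge0. Qed.

Hypothesis cA : forall t, closed_subspace (A t).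

Lemma dyadic_subspace n t : closed_subspace (dyadic n t).
Proof. by case: n => [|n] //=; exact: tens_subspace. Qed.

Lemma dyadic_limit_subspace t : closed_subspace (dyadic_limit t).
Proof. exact: closed_span_subspace. Qed.

Lemma sub_dyadic_limit n t : dyadic n t `<=` dyadic_limit t.
Proof. by move=> x hx; apply: sub_closed_span; exists n. Qed.

Lemma dyadic_limit_min (K : forall t, set (H t)) : subsystem K ->
  (forall t, 0 <= t -> A t `<=` K t) -> forall t, 0 <= t -> dyadic_limit t `<=` K t.
Proof.
move=> [cK tK _] AK t t0; apply: closed_span_min; first exact: cK.
move=> x [n _]; elim: n t t0 x => [|n IH] t t0 x; first exact: AK.
rewrite /= -(tK _ _ _ (halves t)) ?half_ge0// => hx.
by move: x hx; apply: tensS; apply: IH; exact: half_ge0.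
Qed.

Hypothesis A_refine : forall s t r (e : s + t = r), 0 <= s -> 0 <= t ->
  A r `<=` tens e (A s) (A t).

(** [A_refine] splits every leaf of the tree in two, and [tens] is monotone. *)
Lemma dyadic_le m n t : (m <= n)%N -> 0 <= t -> dyadic m t `<=` dyadic n t.
Proof.
move=> mn t0; elim: n mn => [|n IH]; first by rewrite leqn0 => /eqP ->.
rewrite leq_eqVlt => /predU1P[-> //|/IH h]; apply: subset_trans h _.
elim: n t t0 {IH} => [|n IH] t t0; first by apply: A_refine; exact: half_ge0.
by apply: tensS; apply: IH; exact: half_ge0.
Qed.

Lemma dyadic_limit_half a b t (e : a + b = t) : 0 <= t -> a = t / 2 -> b = t / 2 ->
  dyadic_limit t = tens e (dyadic_limit a) (dyadic_limit b).
Proof.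
move=> t0 ea eb; have a0 : 0 <= a by rewrite ea half_ge0.
have b0 : 0 <= b by rewrite eb half_ge0.
rewrite /tens /dyadic_limit closed_span_tensor; last exact: amul_ip.
apply/seteqP; split; apply: closed_spanS.
  move=> x [n _] /(dyadic_le (leqnSn n) t0).
  rewrite (dyadicSE n e)//; apply: closed_spanS => _ [y hy [z hz <-]].
  by apply: sub_closed_span; exists y; [exists n|exists z; [exists n|]].
move=> _ [y [n _ hy] [z [m _ hz] <-]]; apply: sub_closed_span.
(* Both halves are raised to the common level [maxn n m]; joining them adds one level. *)
exists (maxn n m).+1 => //; rewrite (dyadicSE _ e)//; apply: mem_tens.
  by apply: dyadic_le hy => //; exact: leq_maxl.
by apply: dyadic_le hz => //; exact: leq_maxr.
Qed.

(* If [K_{a/2}] and [K_{b/2}] commute, the four factors of [K_a (x) K_b] can be regrouped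
   into [(K_{a/2} (x) K_{b/2}) (x) (K_{a/2} (x) K_{b/2})]. *)
Lemma dyadic_limit_tens :
  (forall a b c (e : a + b = c), 0 < a -> 0 < b -> c <= 1 ->
     tens e (dyadic_limit a) (dyadic_limit b) = dyadic_limit c) ->
  forall a b c (e : a + b = c), 0 < a -> 0 < b ->
     tens e (dyadic_limit a) (dyadic_limit b) = dyadic_limit c.
Proof.
move=> tens_le1.
(* Every real [c] lies below some power of 2, and halving lowers the exponent by one. *)
suff main n : forall a b c (e : a + b = c), 0 < a -> 0 < b -> c <= 2 ^+ n ->
    tens e (dyadic_limit a) (dyadic_limit b) = dyadic_limit c.
  move=> a b c e a0 b0; apply: (main (Num.bound c)) => //.
  exact: ltW (upper_nthrootP (leqnn _)).
elim: n => [|n IH] a b c e a0 b0 cn; first by apply: tens_le1; rewrite // -(expr0 2).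
pose a' := a / 2; pose b' := b / 2; pose c' := c / 2.
have a'0 : 0 < a' by rewrite divr_gt0.
have b'0 : 0 < b' by rewrite divr_gt0.
have c'0 : 0 < c' by rewrite divr_gt0// -e addr_gt0.
have g : a' + b' = c' by rewrite /a' /b' /c' -e mulrDl.
have g' : b' + a' = c' by rewrite addrC.
have c'n : c' <= 2 ^+ n by rewrite /c' ler_pdivrMr// -exprSr.
have f1 : a' + (a' + b) = c by rewrite addrA halves.
have f3 : c' + b' = a' + b by rewrite -g -addrA halves.
have f4 : b' + c' = a' + b by rewrite addrC.
pose K := dyadic_limit.
have cK t : closed_subspace (K t) by exact: dyadic_limit_subspace.
have tK s t r (h : s + t = r) X Y : closed_subspace (tens (H := H) h X Y).
  exact: tens_subspace.
have IHab := IH _ _ _ g a'0 b'0 c'n; have IHba := IH _ _ _ g' b'0 a'0 c'n.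
rewrite (dyadic_limit_half (halves a))//; last exact: ltW.
rewrite (dyadic_limit_half (halves b))//; last exact: ltW.
rewrite -/a' -/b'.
(* Writing only the times, the regrouping is (a'a')(b'b') = a'((a'b')b') = a'((b'a')b') =
   a'(b'(a'b')) = (a'b')(a'b'). The swap in the middle holds because [IHab] and [IHba] give the same
   space at time [c']. *)
rewrite (tens_assoc _ e (erefl (a' + b)) f1) ?(ltW a'0) ?(ltW b0)//.
rewrite -(tens_assoc g f3) ?(ltW a'0) ?(ltW b'0)//.
rewrite IHab -IHba.
rewrite (tens_assoc g' f3 g f4) ?(ltW a'0) ?(ltW b'0)//.
rewrite -(tens_assoc g (halves c) f4 f1) ?(ltW a'0) ?(ltW b'0) ?(ltW c'0)//.
rewrite IHab -dyadic_limit_half//; apply: ltW.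
by rewrite -e addr_gt0.
Qed.

End dyadic_limit.

Arguments dyadic {R H} A n t _.
Arguments dyadic_limit {R H} A t _.

(** * Fibres at time zero *)

Section time_zero.
Context (R : realType) (H : arveson R).
Implicit Types s t : R.

(* Associativity gives [xy (x) z = x (x) yz], so that [yz] and [z] are proportional. *)
Lemma amul_time0l t (e : 0 + t = t) (y : H 0) (z : H t) : 0 <= t ->
  exists c : R[i], amul e y z = c *: z.
Proof.
move=> t0; have [->|y0] := eqVneq y 0; first by exists 0; rewrite linear0l scale0r.
pose xy := amul (addr0 0) y y.
have n0 : ip y y != 0 by rewrite ipxx sqrf_eq0 normr_eq0.
(* Pairing both bracketings of [y y z] with [y w] gives <y, y> <yz, w> = <yy, y> <z, w>, whence the
   constant. *)
exists (ip xy y / ip y y); apply: ip_inj => w; rewrite ipZl.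
apply: (mulfI n0); rewrite mulrA mulrCA divff// mulr1 -!(amul_ip e)//.
by rewrite (arveson_assoc (addr0 0) e e e).
Qed.

Lemma amul_time0r t (e : t + 0 = t) (z : H t) (y : H 0) : 0 <= t ->
  exists c : R[i], amul e z y = c *: z.
Proof.
move=> t0; have [->|y0] := eqVneq y 0; first by exists 0; rewrite linear0r scale0r.
pose yx := amul (addr0 0) y y.
have n0 : ip y y != 0 by rewrite ipxx sqrf_eq0 normr_eq0.
exists (ip yx y / ip y y); apply: ip_inj => w; rewrite ipZl.
apply: (mulIf n0); rewrite mulrAC divfK// [_ * ip z _]mulrC -!(amul_ip e)//.
by rewrite (arveson_assoc e e (addr0 0) e).
Qed.

(** A vector at time zero acts on the fibre at [t] as a scalar, and a nonzero vector acts as a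
    nonzero scalar because norms multiply. *)
Lemma tens_time0l t (e : 0 + t = t) (X : set (H 0)) (Y : set (H t)) : 0 <= t ->
  closed_subspace Y -> (exists2 x, X x & x != 0) -> tens e X Y = Y.
Proof.
move=> t0 cY [w Xw w0]; apply/seteqP; split.
  by apply: tens_min => // x y _ Yy; have [c ->] := amul_time0l e x y t0; apply: subspaceZ.
move=> y Yy; have [->|y0] := eqVneq y 0; first by apply: subspace0; exact: tens_subspace.
have [c cE] := amul_time0l e w y t0.
have c0 : c != 0.
  apply: contra_neq y0 => c0; move: cE; rewrite c0 scale0r => /(congr1 (@Num.norm _ _)).
  rewrite (tensor_norm (amul_ip e _ _))// normr0 => /eqP.
  by rewrite mulf_eq0 !normr_eq0 (negbTE w0) => /eqP.
rewrite -[y]scale1r -(mulVf c0) -scalerA -cE.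
by apply: (subspaceZ _ (tens_subspace _ _ _)); exact: mem_tens.
Qed.

Lemma tens_time0r t (e : t + 0 = t) (X : set (H 0)) (Y : set (H t)) : 0 <= t ->
  closed_subspace Y -> (exists2 x, X x & x != 0) -> tens e Y X = Y.
Proof.
move=> t0 cY [w Xw w0]; apply/seteqP; split.
  by apply: tens_min => // y x Yy _; have [c ->] := amul_time0r e y x t0; exact: subspaceZ.
move=> y Yy; have [->|y0] := eqVneq y 0; first by apply: subspace0; exact: tens_subspace.
have [c cE] := amul_time0r e y w t0.
have c0 : c != 0.
  apply: contra_neq y0 => c0; move: cE; rewrite c0 scale0r => /(congr1 (@Num.norm _ _)).
  rewrite (tensor_norm (amul_ip e _ _))// normr0 => /eqP.
  by rewrite mulf_eq0 !normr_eq0 (negbTE w0) orbF => /eqP.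
rewrite -[y]scale1r -(mulVf c0) -scalerA -cE.
by apply: (subspaceZ _ (tens_subspace _ _ _)); exact: mem_tens.
Qed.

End time_zero.

(** * Measurable sections spanning the dyadic limit *)

Section measurable_sections.
Context (R : realType) (H : arveson R).
Implicit Types s t : R.

(** By maximality of the measurable structure it suffices to test against measurable [z]; this is
    [arveson_measurable] pulled back along [t |-> (t / 2, t / 2)]. *)
Lemma msection_half (x y : section H) : msection x -> msection y ->
  msection (fun t => amul (halves t) (x (t / 2)) (y (t / 2))).
Proof.
have [_ maxM _] := arveson_field H.
move=> mx my; apply: maxM => z mz.
have [mre mim] := arveson_measurable mx my mz.
pose D := [set p : R * R | 0 <= p.1 /\ 0 <= p.2].
have mD : measurable D.
  have -> : D = `[0, +oo[%classic `*` `[0, +oo[%classic.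
    by apply/seteqP; split => -[p q]; rewrite /= !in_itv/= !andbT.
  by apply: measurableX; exact: measurable_itv.
pose h := (fun t : R => (t / 2, t / 2)).
have hD : h @` [set t : R | 0 <= t] `<=` D.
  by move=> _ [t t0 <-]; split; exact: half_ge0.
have mh : measurable_fun [set t : R | 0 <= t] h.
  by apply: measurable_funTS; apply: measurable_fun_pair; exact: mulrr_measurable.
have E (t r : R) (e : t / 2 + t / 2 = r) :
    ip (amul e (x (t / 2)) (y (t / 2))) (z r) =
    ip (amul (erefl ((h t).1 + (h t).2)) (x (h t).1) (y (h t).2)) (z ((h t).1 + (h t).2)).
  by case: r / e.
(* Maximality puts the tested section in the second argument of [ip], [arveson_measurable] puts it
   in the first; conjugation links the two. *)
have conjE (c : R[i]) : complex.Re (Num.conj c) = complex.Re c /\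
  complex.Im (Num.conj c) = - complex.Im c by case: c.
split.
  apply: eq_measurable_fun (measurable_comp mD hD mre mh) => t _ /=.
  by rewrite [in RHS]ipC (conjE _).1 [in RHS]E.
have mN := measurableT_comp (@oppr_measurable R setT) (measurable_comp mD hD mim mh).
apply: eq_measurable_fun mN => t _ /=.
by rewrite [in RHS]ipC (conjE _).2 [in RHS]E.
Qed.

(** The index [k] codes a pair of indices, one for each half; a [k] that codes no pair is read as
    [(0, 0)], which only repeats a section. *)
Fixpoint dyadic_section (a : nat -> section H) (n k : nat) : section H :=
  if n is n'.+1 then
    let p := odflt (0, 0)%N (unpickle k) in
    fun t => amul (halves t) (dyadic_section a n' p.1 (t / 2)) (dyadic_section a n' p.2 (t / 2))
  else a k.

Context (A : forall t, set (H t)) (a : nat -> section H).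
Arguments A : clear implicits.
Hypothesis ma : forall n, msection (a n).
Hypothesis aA : forall t, 0 <= t -> closed_span (range (fun n => a n t)) = A t.

Lemma dyadic_section_msection n k : msection (dyadic_section a n k).
Proof. by elim: n k => //= n IH k; exact: msection_half. Qed.

Lemma dyadic_section_span n t : 0 <= t ->
  closed_span (range (fun k => dyadic_section a n k t)) = dyadic A n t.
Proof.
elim: n t => //= n IH t t0; rewrite -!IH ?half_ge0// /tens closed_span_tensor; last first.
  by apply: amul_ip; exact: half_ge0.
congr closed_span; apply/seteqP; split.
  by move=> _ [k _ <-] /=; exists (dyadic_section a n (odflt (0, 0)%N (unpickle k)).1 (t / 2));
    [eexists|exists (dyadic_section a n (odflt (0, 0)%N (unpickle k)).2 (t / 2)); [eexists|]].
by move=> _ [_ [i _ <-] [_ [j _ <-] <-]]; exists (pickle (i, j)) => //; rewrite pickleK.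
Qed.

Lemma dyadic_limit_sections : exists x : nat -> section H,
  (forall n, msection (x n)) /\
  forall t, 0 <= t -> closed_span (range (fun n => x n t)) = dyadic_limit A t.
Proof.
pose x k := let p := odflt (0, 0)%N (unpickle k) in dyadic_section a p.1 p.2.
exists x; split=> [k|t t0]; first exact: dyadic_section_msection.
apply/seteqP; split; apply: closed_spanS.
  move=> _ [k _ <-]; set p := odflt (0, 0)%N (unpickle k).
  apply: (@sub_dyadic_limit _ _ _ p.1); rewrite -dyadic_section_span//.
  by apply: sub_closed_span; exists p.2.
move=> y [n _]; rewrite -dyadic_section_span//; apply: closed_spanS => _ [k _ <-].
by apply: sub_closed_span; exists (pickle (n, k)) => //; rewrite /x pickleK.
Qed.

Hypothesis A_refine : forall s t r (e : s + t = r), 0 <= s -> 0 <= t ->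
  A r `<=` tens e (A s) (A t).
Hypothesis A0 : exists2 x, A 0 x & x != 0.

Lemma dyadic_limit_subsystem :
  (forall a b c (e : a + b = c), 0 < a -> 0 < b -> c <= 1 ->
     tens e (dyadic_limit A a) (dyadic_limit A b) = dyadic_limit A c) ->
  subsystem (dyadic_limit A).
Proof.
move=> tens_le1; split.
- by move=> t _; exact: dyadic_limit_subspace.
- move=> s t r e s0 t0; rewrite -/(tens e (dyadic_limit A s) (dyadic_limit A t)).
  (* [dyadic_limit_tens] covers positive times only; a time-zero factor containing a nonzero vector
     is absorbed by the other factor. *)
  have K0 : exists2 x, dyadic_limit A 0 x & x != 0.
    by have [x Ax x0] := A0; exists x => //; apply: (@sub_dyadic_limit _ _ _ 0).
  move: s0; rewrite le_eqVlt => /predU1P[s0|s0].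
    have rt : r = t by rewrite -e -s0 add0r.
    move: e; rewrite rt -s0 => e; apply: tens_time0l => //; exact: dyadic_limit_subspace.
  move: t0; rewrite le_eqVlt => /predU1P[t0|t0].
    have rs : r = s by rewrite -e -t0 addr0.
    move: e; rewrite rs -t0 => e; apply: tens_time0r => //; first exact: ltW; exact: dyadic_limit_subspace.
  exact: dyadic_limit_tens.
have [x [mx xK]] := dyadic_limit_sections.
exists x; split=> // n; split=> // t t0.
by rewrite -xK//; apply: sub_closed_span; exists n.
Qed.

End measurable_sections.

(** * Pairs of closed sets and the isomorphism J *)

Section random_sets.
Context (R : realType).
Implicit Types (s t : R) (Z : pair01 R).

Lemma closed01_subbase_open (X : set (closed01 R)) : closed01_subbase X -> open X.
Proof.
move=> hX; exists [set X]; last by rewrite bigcup_set1.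
by move=> _ ->; exact: (finI_from1 id hX).
Qed.

Lemma measurable_miss s t :
  measurable [set Z : closed01 R | closed01_set Z `&` `[s, t] = set0].
Proof.
apply: sub_sigma_algebra; apply: closed01_subbase_open; left.
by exists `[s, t]%classic => //; exact: segment_compact.
Qed.

Definition miss1 s t : set (pair01 R) := [set Z | closed01_set Z.1 `&` `[s, t] = set0].
Definition miss2 s t : set (pair01 R) := [set Z | closed01_set Z.2 `&` `[s, t] = set0].
Definition disjoint_on s t : set (pair01 R) :=
  [set Z | closed01_set Z.1 `&` closed01_set Z.2 `&` `[s, t] = set0].

Lemma measurable_miss1 s t : measurable (miss1 s t).
Proof.
have -> : miss1 s t = fst @^-1` [set Z : closed01 R | closed01_set Z `&` `[s, t] = set0] by [].
rewrite -[X in measurable X]setTI; apply: measurable_fst => //; exact: measurable_miss.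
Qed.

Lemma measurable_miss2 s t : measurable (miss2 s t).
Proof.
have -> : miss2 s t = snd @^-1` [set Z : closed01 R | closed01_set Z `&` `[s, t] = set0] by [].
rewrite -[X in measurable X]setTI; apply: measurable_snd => //; exact: measurable_miss.
Qed.

Definition mid s t := (s + t) / 2.

(* Each of the [2 ^ n] equal subintervals of [s, t] misses one of the two sets. *)
Fixpoint piecewise_miss (n : nat) s t : set (pair01 R) :=
  if n is n'.+1 then piecewise_miss n' s (mid s t) `&` piecewise_miss n' (mid s t) t
  else miss1 s t `|` miss2 s t.

Lemma measurable_piecewise_miss n s t : measurable (piecewise_miss n s t).
Proof.
elim: n s t => [|n IH] s t /=; last exact: measurableI.
by apply: measurableU; [exact: measurable_miss1|exact: measurable_miss2].
Qed.

Lemma mid_ge s t : s <= t -> s <= mid s t. Proof. rewrite /mid; lra. Qed.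
Lemma mid_le s t : s <= t -> mid s t <= t. Proof. rewrite /mid; lra. Qed.

Lemma sub_itv_miss (X : set R) a b c d : a <= c -> d <= b ->
  X `&` `[a, b] = set0 -> X `&` `[c, d] = set0.
Proof.
move=> ac db; rewrite -!subset0 => h x [Xx]; rewrite /= in_itv/= => /andP[cx xd].
by apply: (h x); split=> //; rewrite /= in_itv/= (le_trans ac)// (le_trans xd).
Qed.

Lemma sub_piecewise_missS n s t : s <= t -> piecewise_miss n s t `<=` piecewise_miss n.+1 s t.
Proof.
elim: n s t => [|n IH] s t st Z.
  move=> [] h; split; [left|left|right|right];
    apply: sub_itv_miss h; rewrite ?mid_ge ?mid_le//.
by move=> [h1 h2]; split; apply: IH => //; rewrite ?mid_ge ?mid_le.
Qed.

Lemma piecewise_miss_disjoint n s t : s <= t -> piecewise_miss n s t `<=` disjoint_on s t.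
Proof.
elim: n s t => [|n IH] s t st Z.
  by case; rewrite /miss1 /miss2 /disjoint_on /= -!subset0 => h x [[Z1 Z2] xst]; apply: (h x).
move=> [/(IH _ _ (mid_ge st)) h1 /(IH _ _ (mid_le st)) h2].
move: h1 h2; rewrite /disjoint_on /= -!subset0 => h1 h2 x [Zx].
rewrite /= in_itv/= => /andP[sx xt]; have [xm|mx] := leP x (mid s t).
  by apply: (h1 x); split=> //; rewrite /= in_itv/= sx.
by apply: (h2 x); split=> //; rewrite /= in_itv/= xt ltW.
Qed.

(** If both sets met an interval of the subdivision, two of their points would be within its length
    [(t - s) / 2 ^ n]. *)
Lemma piecewise_miss_of_dist n s t Z : s <= t ->
  (forall x y, closed01_set Z.1 x -> closed01_set Z.2 y -> x \in `[s, t] -> y \in `[s, t] ->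
     (t - s) / 2 ^+ n < `|x - y|) ->
  piecewise_miss n s t Z.
Proof.
elim: n s t => [|n IH] s t st h.
  have [h1|/eqP/set0P[x [Zx xst]]] := pselect (closed01_set Z.1 `&` `[s, t] = set0); first by left.
  right; rewrite /miss2/= -subset0 => y [Zy yst].
  have := h _ _ Zx Zy xst yst; rewrite expr0 divr1 ltNge => /negP; apply.
  move: xst yst; rewrite /= !in_itv/= => /andP[? ?] /andP[? ?].
  by rewrite ler_norml; apply/andP; split; lra.
have E1 : (mid s t - s) / 2 ^+ n = (t - s) / 2 ^+ n.+1.
  by rewrite /mid exprS; field; rewrite expf_neq0.
have E2 : (t - mid s t) / 2 ^+ n = (t - s) / 2 ^+ n.+1.
  by rewrite /mid exprS; field; rewrite expf_neq0.
have ms := mid_ge st; have mt := mid_le st.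
split; apply: IH => // x y Zx Zy; rewrite ?E1 ?E2 !in_itv/= => /andP[? ?] /andP[? ?];
  apply: h => //; rewrite in_itv/=; apply/andP; split; lra.
Qed.

(** The compact [K1] and the closed [K2] are disjoint, so they lie a positive distance apart;
    [piecewise_miss_of_dist] applies once the mesh is smaller. *)
Lemma disjoint_on_bigcup s t : s < t -> disjoint_on s t = \bigcup_n piecewise_miss n s t.
Proof.
move=> st; apply/seteqP; split; last first.
  by move=> Z [n _]; apply: piecewise_miss_disjoint; exact: ltW.
move=> Z hZ.
pose K1 := closed01_set Z.1 `&` `[s, t]; pose K2 := closed01_set Z.2 `&` `[s, t].
have cK1 : compact K1.
  rewrite /K1 setIC; apply: compact_closedI; first exact: segment_compact.
  exact: closed01_closed.
have cK2 : closed K2.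
  by apply: closedI; [exact: closed01_closed|exact: itv_closed].
(* The near-covering form of compactness turns a level depending on the point [x] into one valid for
   all of [K1]. *)
have /compact_near_coveringP ncov := cK1.
have : \forall n \near \oo, forall x, K1 x ->
    (fun n x => forall y, K2 y -> (t - s) / 2 ^+ n < `|x - y|) n x.
  apply: ncov => x [Zx xst].
  have xK2 : (~` K2) x.
    by move=> [Zx' _]; move: hZ; rewrite /disjoint_on /= -subset0 => /(_ x); apply.
  have : nbhs x (~` K2) by apply: open_nbhs_nbhs; split => //; exact: closed_openC.
  move=> /nbhs_ballP[e /= e0 he].
  have e20 : 0 < e / 2 by rewrite divr_gt0.
  have small : \forall n \near \oo, (t - s) / 2 ^+ n < e / 2.
    have : (fun n => (t - s) / 2 ^+ n) @ \oo --> (0 : R).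
      under eq_fun do rewrite -exprVn.
      by apply: cvg_geometric; rewrite ger0_norm ?invr_ge0// invf_lt1// ltr1n.
    move=> /cvgrPdist_lt /(_ _ e20); apply: filterS => n; rewrite sub0r normrN ger0_norm//.
    by rewrite divr_ge0 ?exprn_ge0// subr_ge0 ltW.
  (* A point of [K2] within the mesh of some [x'] in this ball would be within e/2 + e/2 of [x]. *)
  exists (ball x (e / 2), [set n | (t - s) / 2 ^+ n < e / 2]) => /=.
    by split => //; apply: nbhsx_ballx.
  move=> [x' n] /= [bx' hn] y Ky.
  apply: lt_trans hn _; rewrite ltNge; apply/negP => xy.
  apply: (he y) => //; rewrite /ball/=.
  rewrite -(subrK x' x) -addrA; apply: le_lt_trans (ler_normD _ _) _.
  by rewrite [e]splitr ltr_leD.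
move=> [N _ hN]; exists N => //; apply: piecewise_miss_of_dist; first exact: ltW.
by move=> x y Zx Zy xst yst; apply: (hN N) => //=.
Qed.

End random_sets.

(** * Projections obtained from indicator functions *)

Section indicator_calculus.
Context (R : realType) d (T : measurableType d) (mu : {measure set T -> \bar R}).
Context (H : hilbert R) (J : (T -> R[i]) -> H -> H).
Implicit Types A B : set T.

Let chi A : T -> R[i] := \1_A.

Lemma Re_indic A : (fun z => complex.Re (chi A z)) = \1_A :> (T -> R).
Proof. by apply/funext => z; rewrite /chi !indicE; case: (_ \in _). Qed.

Lemma Im_indic A : (fun z => complex.Im (chi A z)) = cst 0 :> (T -> R).
Proof. by apply/funext => z; rewrite /chi !indicE; case: (_ \in _). Qed.

Lemma bounded_Lfun_infty (f : T -> R) (M : R) : measurable_fun setT f ->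
  (forall z, `|f z| <= M) -> f \in Lfun mu +oo%E.
Proof.
move=> mf fM; rewrite inE; apply/andP; split; rewrite inE//=.
rewrite /finite_norm unlock /Lnorm; case: ifPn => // _.
apply: (@le_lt_trans _ _ M%:E); last exact: ltry.
by apply/ess_supP; apply: aeW => z /=; rewrite lee_fin.
Qed.

Lemma Linfty_indic A : measurable A -> Linfty mu (chi A).
Proof.
move=> mA; split; rewrite ?Re_indic ?Im_indic; apply: (@bounded_Lfun_infty _ 1).
- exact: measurable_indic.
- by move=> z; rewrite indicE ger0_norm//; case: (_ \in _).
- exact: measurable_cst.
- by move=> z; rewrite normr0.
Qed.

Lemma ae_le_indic A B : A `<=` B -> ae_le mu (chi A) (chi B).
Proof.
move=> AB; apply: aeW => z; rewrite /chi !indicE ler_nat.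
by case: (boolP (z \in A)) => [/set_mem/AB/mem_set ->|].
Qed.

Hypothesis hJ : normal_star_iso mu J.

Lemma J_indic_bounded A : measurable A -> bounded_op (J (chi A)).
Proof. by move=> /Linfty_indic /(J_bounded hJ). Qed.

Lemma J_indicI A B x : measurable A -> measurable B ->
  J (chi (A `&` B)) x = J (chi A) (J (chi B) x).
Proof.
move=> mA mB; rewrite -[RHS]/((J (chi A) \o J (chi B)) x).
rewrite -(J_mul hJ); [|exact: Linfty_indic..].
by congr J; rewrite /chi indicI.
Qed.

Lemma J_indic_sub A B x : measurable A -> measurable B -> A `<=` B ->
  J (chi B) (J (chi A) x) = J (chi A) x.
Proof. by move=> mA mB /setIidPr AB; rewrite -J_indicI// AB. Qed.

(** An indicator is real and idempotent, so its image under [J] is self-adjoint and idempotent. *)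
Lemma J_indic_ip A x : measurable A -> ip (J (chi A) x) x = `|J (chi A) x| ^+ 2.
Proof.
move=> mA; rewrite -{1}(J_indic_sub x mA mA)//.
rewrite (J_adjoint hJ (Linfty_indic mA)) -ipxx; congr (ip _ (J _ x)).
by apply/funext => z; rewrite /chi indicE rmorph_nat.
Qed.

(** The union is the disjoint union of [A] and [B \ A], and the operator of [B \ A] factors through
    that of [B]. *)
Lemma J_indicU_eq0 A B x : measurable A -> measurable B ->
  J (chi A) x = 0 -> J (chi B) x = 0 -> J (chi (A `|` B)) x = 0.
Proof.
move=> mA mB Ax Bx; have mBA : measurable (B `\` A) by exact: measurableD.
have -> : chi (A `|` B) = (fun z => 1 * chi A z + chi (B `\` A) z).
  apply/funext => z; rewrite /chi !indicE mul1r classical_sets.in_setU classical_sets.in_setD.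
  by case: (z \in A); case: (z \in B); rewrite ?addr0 ?add0r.
rewrite (J_linear hJ); [|exact: Linfty_indic..].
rewrite Ax scaler0 add0r.
have -> : B `\` A = (B `\` A) `&` B by apply/esym/setIidPl => z [].
rewrite J_indicI// Bx.
by have [lin _] := J_indic_bounded mBA; exact: linear_fun0.
Qed.

(** The indicator of the union is the supremum of the increasing indicators, so normality makes its
    image the least bounded upper bound of their images. *)
Lemma J_indic_bigcup_le (A : nat -> set T) (P : H -> H) :
  (forall n, measurable (A n)) -> (forall m n, (m <= n)%N -> A m `<=` A n) ->
  bounded_op P -> (forall n, op_le (J (chi (A n))) P) -> op_le (J (chi (\bigcup_n A n))) P.
Proof.
move=> mA ndA bP AP.
have mU : measurable (\bigcup_n A n) by exact: bigcup_measurable.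
have := @J_normal _ _ _ _ _ _ hJ (range (fun n => chi (A n))) (chi (\bigcup_n A n)).
case.
- move=> _ [n _ <-]; split; first exact: Linfty_indic.
  by apply: aeW => z; rewrite /chi indicE ler0n.
- split; first by exists (chi (A 0)), 0.
  move=> _ _ [m _ <-] [n _ <-]; exists (chi (A (maxn m n))); split; first by exists (maxn m n).
    by apply: ae_le_indic; apply: ndA; exact: leq_maxl.
  by apply: ae_le_indic; apply: ndA; exact: leq_maxr.
- split; first exact: Linfty_indic.
    by move=> _ [n _ <-]; apply: ae_le_indic; exact: bigcup_sup.
  move=> c _ cA.
  (* Countably many almost sure inequalities hold together outside one null set. *)
  have : \forall z \ae mu, forall n, chi (A n) z <= c z.
    by apply: ae_foralln => n; apply: cA; exists n.
  apply: filterS => z hz; rewrite /chi indicE.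
  have [/set_mem[n _ Az]|_] := boolP (_ \in _).
    by have := hz n; rewrite /chi indicE mem_set.
  by apply: le_trans (hz 0); rewrite /chi indicE ler0n.
by move=> _ _; apply => //; move=> _ [_ [n _ <-] <-]; exact: AP.
Qed.

End indicator_calculus.

(** * The spatial product *)

Section spatial_product_projection.
Context (R : realType) (E F : arveson R) (u : section E) (v : section F).
Hypotheses (hu : normalised_unit u) (hv : normalised_unit v).
Context (T : tensor_system E F).
Implicit Types a b c r s t : R.

Definition two_units t : set (T t) := closed_span (unit_tensor T u t `|` tensor_unit T v t).
Arguments two_units : clear implicits.

Lemma two_units_subspace t : closed_subspace (two_units t).
Proof. exact: closed_span_subspace. Qed.

Lemma sub_unit_tensor t : unit_tensor T u t `<=` two_units t.
Proof. by move=> x h; apply: sub_closed_span; left. Qed.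

Lemma sub_tensor_unit t : tensor_unit T v t `<=` two_units t.
Proof. by move=> x h; apply: sub_closed_span; right. Qed.

Lemma unit_tensor_mem t y : unit_tensor T u t (tmap T t (u t) y).
Proof.
apply: sub_closed_span; exists (u t); first by exists 1 => //; rewrite scale1r.
by exists y.
Qed.

Lemma tensor_unit_mem t x : tensor_unit T v t (tmap T t x (v t)).
Proof.
apply: sub_closed_span; exists x => //; exists (v t) => //.
by exists 1 => //; rewrite scale1r.
Qed.

Lemma tmap_ip t : 0 <= t ->
  forall x x' y y', ip (tmap T t x y) (tmap T t x' y') = ip x x' * ip y y'.
Proof. by move=> t0; case: (tmap_tensor T t0). Qed.

(** The total set [Y] will consist of product vectors in [two_units_refine] and of a generating
    sequence of sections in [two_units_sections]. *)
Lemma unit_tensor_min t (Y : set (F t)) (Z : set (T t)) : 0 <= t ->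
  closed_span Y = setT -> closed_subspace Z ->
  (forall y, Y y -> Z (tmap T t (u t) y)) -> unit_tensor T u t `<=` Z.
Proof.
move=> t0 YT cZ h; apply: closed_span_min => // _ [_ [k _ <-] [y _ <-]].
rewrite linearZl_LR; apply: (subspaceZ _ cZ).
have : closed_span Y y by rewrite YT.
apply: (@closed_span_min _ _ Y (tmap T t (u t) @^-1` Z)) => //.
apply: preimage_subspace => //; first exact: tensor_linearr.
exact: tensor_continuousr (tmap_ip t0) _.
Qed.

Lemma tensor_unit_min t (X : set (E t)) (Z : set (T t)) : 0 <= t ->
  closed_span X = setT -> closed_subspace Z ->
  (forall x, X x -> Z (tmap T t x (v t))) -> tensor_unit T v t `<=` Z.
Proof.
move=> t0 XT cZ h; apply: closed_span_min => // _ [x _ [_ [k _ <-] <-]].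
rewrite linearZr_LR; apply: (subspaceZ _ cZ).
have : closed_span X x by rewrite XT.
apply: (@closed_span_min _ _ X ((fun x => tmap T t x (v t)) @^-1` Z)) => //.
apply: preimage_subspace => //; first exact: tensor_linearl.
exact: tensor_continuousl (tmap_ip t0) _.
Qed.

(** Since [u] is a unit, [u_r (x) yy'] is the product of [u_s (x) y] and [u_t (x) y']; likewise for
    [v]. *)
Lemma two_units_refine s t r (e : s + t = r) : 0 <= s -> 0 <= t ->
  two_units r `<=` tens e (two_units s) (two_units t).
Proof.
move=> s0 t0; have r0 : 0 <= r by rewrite -e addr_ge0.
have [_ _ um] := hu; have [_ _ vm] := hv.
apply: closed_span_min; first exact: tens_subspace.
rewrite subUset; split.
  apply: (unit_tensor_min r0 (@amul_total _ F _ _ _ e s0 t0)); first exact: tens_subspace.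
  move=> _ [y _ [y' _ <-]]; rewrite (um _ _ _ e)// -tmap_amul//.
  by apply: mem_tens; apply: sub_unit_tensor; exact: unit_tensor_mem.
apply: (tensor_unit_min r0 (@amul_total _ E _ _ _ e s0 t0)); first exact: tens_subspace.
move=> _ [y _ [y' _ <-]]; rewrite (vm _ _ _ e)// -tmap_amul//.
by apply: mem_tens; apply: sub_tensor_unit; exact: tensor_unit_mem.
Qed.

Lemma two_units_sections : exists a : nat -> section T,
  (forall n, msection (a n)) /\
  forall t, 0 <= t -> closed_span (range (fun n => a n t)) = two_units t.
Proof.
have [mu_ _ _] := hu; have [mv _ _] := hv.
have [_ _ [x [mx xE]]] := arveson_field E.
have [_ _ [y [my yF]]] := arveson_field F.
(* The two generating sequences are interleaved: [u (x) y_k] at odd indices, [x_k (x) v] at even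
   ones. *)
exists (fun n t => if odd n then tmap T t (u t) (y n./2 t) else tmap T t (x n./2 t) (v t)).
split=> [n|t t0]; first by case: (odd n); exact: tmap_msection.
apply/seteqP; split; apply: closed_span_min; try exact: closed_span_subspace.
  move=> _ [n _ <-] /=; case: ifPn => _.
    by apply: sub_unit_tensor; exact: unit_tensor_mem.
  by apply: sub_tensor_unit; exact: tensor_unit_mem.
rewrite subUset; split.
  apply: (unit_tensor_min t0 (yF _ t0)); first exact: closed_span_subspace.
  move=> _ [n _ <-]; apply: sub_closed_span; exists n.*2.+1 => //=.
  by rewrite odd_double/= uphalf_double.
apply: (tensor_unit_min t0 (xE _ t0)); first exact: closed_span_subspace.
move=> _ [n _ <-]; apply: sub_closed_span; exists n.*2 => //=.
by rewrite odd_double/= doubleK.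
Qed.

Lemma unit_neq0 t : 0 <= t -> tmap T t (u t) (v t) != 0.
Proof.
have [_ un _] := hu; have [_ vn _] := hv.
by move=> t0; rewrite -normr_eq0 (tensor_norm (tmap_ip t0)) un// vn// mulr1 oner_eq0.
Qed.

Lemma fibre_neq0 t : 0 <= t -> exists x : T t, x != 0.
Proof. by move=> t0; exists (tmap T t (u t) (v t)); exact: unit_neq0. Qed.

Context (mu : probability (pair01 R) R) (J : (pair01 R -> R[i]) -> T 1 -> T 1).
Hypothesis hJ : is_J (tensor_unit T v) (unit_tensor T u) mu J.

Let Jiso : normal_star_iso mu J. Proof. exact: J_iso hJ. Qed.

(** A vector from either generating subspace is already fixed by the operator of one event; a vector
    orthogonal to both is killed by the operators of both events, hence by that of their union. *)
Lemma J_piecewise_miss0 s t : 0 <= s -> s < t -> t <= 1 ->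
  J (\1_(piecewise_miss 0 s t)) = orth_proj (amul3_span (two_units (t - s))).
Proof.
move=> s0 st t1; have st' := ltW st.
have m1 := measurable_miss1 s t; have m2 := measurable_miss2 s t.
have mU := measurableU _ _ m1 m2.
have P1 : J (\1_(miss1 s t)) = orth_proj (amul3_span (tensor_unit T v (t - s))).
  rewrite (J_fst hJ)//; apply: proj_opE => //; exact: closed_span_subspace.
have P2 : J (\1_(miss2 s t)) = orth_proj (amul3_span (unit_tensor T u (t - s))).
  rewrite (J_snd hJ)//; apply: proj_opE => //; exact: closed_span_subspace.
have cG1 : closed_subspace (tensor_unit T v (t - s)) by exact: closed_span_subspace.
have cG2 : closed_subspace (unit_tensor T u (t - s)) by exact: closed_span_subspace.
have bQ : bounded_op (J (\1_(piecewise_miss 0 s t))) := J_indic_bounded Jiso mU.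
apply: orth_proj_amul3_spanP => //; first exact: two_units_subspace.
- move=> x y z.
  move: y; apply: closed_span_min => [|y [|] Gy /=]; first exact: amul3_fixed_subspace.
    have <- : J (\1_(miss2 s t)) (amul3 x y z) = amul3 x y z.
      by rewrite P2 orth_proj_amul3// orth_proj_id.
    by apply: (J_indic_sub Jiso) => //; exact: subsetUr.
  have <- : J (\1_(miss1 s t)) (amul3 x y z) = amul3 x y z.
    by rewrite P1 orth_proj_amul3// orth_proj_id.
  by apply: (J_indic_sub Jiso) => //; exact: subsetUl.
- move=> x y z yA; apply: (J_indicU_eq0 Jiso) => //.
    rewrite P1 orth_proj_amul3// orth_proj_eq0//; last first.
      by move=> y' Gy'; apply: yA; exact: sub_tensor_unit.
    exact: linear_fun0 (amul3_linear x z).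
  rewrite P2 orth_proj_amul3// orth_proj_eq0//; last first.
    by move=> y' Gy'; apply: yA; exact: sub_unit_tensor.
  exact: linear_fun0 (amul3_linear x z).
Qed.

Lemma J_piecewise_miss n s t : 0 <= s -> s < t -> t <= 1 ->
  J (\1_(piecewise_miss n s t)) = orth_proj (amul3_span (dyadic two_units n (t - s))).
Proof.
elim: n s t => [|n IH] s t s0 st t1; first exact: J_piecewise_miss0.
have sm : s < mid s t by rewrite /mid; lra.
have mt : mid s t < t by rewrite /mid; lra.
have e : (mid s t - s) + (t - mid s t) = t - s by rewrite addrC subrKA.
rewrite (dyadicSE two_units n e); [|by rewrite /mid; field..].
rewrite -amul3_span_comp ?(ltW sm) ?(ltW mt)//; try exact: (dyadic_subspace two_units_subspace).
rewrite -!IH//; [|lra..].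
by apply/funext => w; apply: (J_indicI Jiso); exact: measurable_piecewise_miss.
Qed.

(** The dyadic spaces are fixed because each [piecewise_miss] event is contained in [disjoint_on];
    vectors orthogonal to all of them are killed by the upper bound that normality provides. *)
Lemma J_disjoint_on s t : 0 <= s -> s < t -> t <= 1 ->
  J (\1_(disjoint_on s t)) = orth_proj (amul3_span (dyadic_limit two_units (t - s))).
Proof.
move=> s0 st t1; have st' := ltW st.
have mS n : measurable (piecewise_miss n s t) by exact: measurable_piecewise_miss.
have E1 := disjoint_on_bigcup st.
have mD : measurable (disjoint_on s t) by rewrite E1; exact: bigcup_measurable.
have cK : closed_subspace (dyadic_limit two_units (t - s)) by exact: dyadic_limit_subspace.
have cB n : closed_subspace (dyadic two_units n (t - s)).
  exact: (dyadic_subspace two_units_subspace).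
have bQ := J_indic_bounded Jiso mD.
apply: orth_proj_amul3_spanP => //.
- move=> x y z.
  move: y; apply: closed_span_min => [|y [n _ By] /=]; first exact: amul3_fixed_subspace.
  have <- : J (\1_(piecewise_miss n s t)) (amul3 x y z) = amul3 x y z.
    by rewrite J_piecewise_miss// orth_proj_amul3// orth_proj_id.
  by apply: (J_indic_sub Jiso) => //; exact: piecewise_miss_disjoint.
- move=> x y z yK.
  have := J_indic_bigcup_le Jiso (A := fun n => piecewise_miss n s t)
    (P := orth_proj (amul3_span (dyadic_limit two_units (t - s)))) mS.
  rewrite -E1 => /(_ _ _ _ (amul3 x y z)) h.
  (* With Q the operator of [disjoint_on], P the projection and w the tensor, |Qw|^2 = <Qw, w> <=
     <Pw, w> = 0. *)
  apply: ipxx_le0; rewrite ipxx -(J_indic_ip Jiso)//.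
  apply: le_trans (h _ _ _) _.
  + move=> m n mn; elim: n mn => [|n IH]; first by rewrite leqn0 => /eqP ->.
    rewrite leq_eqVlt => /predU1P[-> //|/IH hm]; apply: subset_trans hm _.
    exact: sub_piecewise_missS.
  + by apply: orth_proj_bounded_op; exact: closed_span_subspace.
  + move=> n; rewrite J_piecewise_miss//; apply: orth_proj_mono; try exact: closed_span_subspace.
    apply: closed_spanS => _ [x' [y' [z' [By' ->]]]]; apply: sub_closed_span.
    by exists x', y', z'; split=> //; exact: sub_dyadic_limit By'.
  rewrite orth_proj_amul3// orth_proj_eq0//.
  by rewrite (linear_fun0 (amul3_linear x z)) ip0l.
Qed.

Lemma disjoint_onI s m t : s <= m -> m <= t ->
  disjoint_on s m `&` disjoint_on m t = disjoint_on s t.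
Proof.
move=> sm mt; apply/seteqP; split=> Z; rewrite /disjoint_on /= -!subset0.
  move=> [h1 h2] x [Zx]; rewrite /= in_itv/= => /andP[sx xt].
  have [xm|mx] := leP x m; first by apply: (h1 x); split=> //; rewrite /= in_itv/= sx.
  by apply: (h2 x); split=> //; rewrite /= in_itv/= ltW.
move=> h; split=> x [Zx]; rewrite /= in_itv/= => /andP[? ?]; apply: (h x); split=> //;
  rewrite /= in_itv/=; apply/andP; split; lra.
Qed.

(** The events for [0, a] and [a, c] intersect in the one for [0, c]. Applying [J] gives equal
    projections on [H_1], and the outer factors, at times 0 and 1 - c, are nonzero and cancel. *)
Lemma dyadic_limit_tens_le1 a b c (e : a + b = c) : 0 < a -> 0 < b -> c <= 1 ->
  tens e (dyadic_limit two_units a) (dyadic_limit two_units b) = dyadic_limit two_units c.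
Proof.
move=> a0 b0 c1.
(* The projections yield the times [a - 0], [c - a] and [c - 0], which must be replaced by [a], [b]
   and [c] simultaneously. *)
have transport a' b' c' (e' : a' + b' = c') : a' = a -> b' = b -> c' = c ->
    tens e' (dyadic_limit two_units a') (dyadic_limit two_units b') =
      dyadic_limit two_units c' ->
    tens e (dyadic_limit two_units a) (dyadic_limit two_units b) = dyadic_limit two_units c.
  by move=> ea eb ec; move: e'; rewrite ea eb ec => e'; rewrite (eq_irrelevance e e').
have e' : (a - 0) + (c - a) = c - 0 by rewrite !subr0 subrKC.
apply: (transport _ _ _ e'); [by rewrite subr0|by rewrite -e addrAC subrr add0r|by rewrite subr0|].
have ac : a < c by rewrite -e ltrDl.
have c0 : 0 < c by exact: lt_trans ac.
have cK r : closed_subspace (dyadic_limit two_units r) by exact: dyadic_limit_subspace.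
apply: (amul3_span_inj (lexx 0) (ltW c0) c1) => //.
- exact: tens_subspace.
- exact: fibre_neq0.
- by apply: fibre_neq0; rewrite subr_ge0.
rewrite -amul3_span_comp ?(ltW a0) ?(ltW ac)// -!J_disjoint_on ?(ltW a0) ?(le_trans (ltW ac) c1)//.
have mD p q : p < q -> measurable (disjoint_on p q : set (pair01 R)).
  move=> pq; rewrite disjoint_on_bigcup//; apply: bigcup_measurable => n _.
  exact: measurable_piecewise_miss.
apply/funext => w /=; rewrite -(J_indicI Jiso)//; [|exact: mD..].
by rewrite disjoint_onI ?ltW.
Qed.

Lemma spatial_productE t : 0 <= t -> spatial_product T u v t = dyadic_limit two_units t.
Proof.
move=> t0; have [a [ma aA]] := two_units_sections.
have subK : subsystem (dyadic_limit two_units).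
  apply: (dyadic_limit_subsystem ma aA two_units_refine).
    exists (tmap T 0 (u 0) (v 0)); last exact: unit_neq0.
    by apply: sub_unit_tensor; exact: unit_tensor_mem.
  exact: dyadic_limit_tens_le1.
apply/seteqP; split=> x.
  apply; first exact: subK.
  (* Level 0 of the dyadic approximation is [two_units] itself. *)
  move=> r r0; split => y hy; apply: (@sub_dyadic_limit _ _ two_units 0).
    exact: sub_unit_tensor.
  exact: sub_tensor_unit.
move=> hx K sK AK; move: t t0 x hx.
apply: dyadic_limit_min => // t t0; have [cK _ _] := sK.
apply: closed_span_min; first exact: cK.
by rewrite subUset; split; case: (AK t t0).
Qed.

End spatial_product_projection.

Arguments two_units {R E F} u v T t _.

Theorem proposition5p2 (R : realType) (E F : arveson R)
  (u : section E) (v : section F)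
  (hu : normalised_unit u) (hv : normalised_unit v)
  (EF : tensor_system E F)
  (mu : probability (pair01 R) R) (J : (pair01 R -> R[i]) -> EF 1 -> EF 1)
  (hJ : is_J (tensor_unit EF v) (unit_tensor EF u) mu J)
  (s t : R) (hs : 0 <= s) (hst : s < t) (ht : t <= 1) :
  proj_op (spatial_product EF u v) s t =
  J (\1_[set Z : pair01 R |
           closed01_set Z.1 `&` closed01_set Z.2 `&` `[s, t] = set0]).
Proof.
have ts0 : 0 <= t - s by rewrite subr_ge0 ltW.
have cK : closed_subspace (dyadic_limit (two_units u v EF) (t - s)).
  exact: dyadic_limit_subspace.
(* Both sides become the projection onto [amul3_span] of the dyadic limit at time [t - s]. *)
rewrite -/(disjoint_on s t) (J_disjoint_on hJ)//.
apply: proj_opE => //; first exact: ltW.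
exact: (spatial_productE hu hv hJ).
Qed.
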